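(* Let $\mathbf G=\mathbf T\ltimes\mathbf U$ with $\mathbf T$ a torus and $\mathbf U$ unipotent of nilpotency class $n$. Let $A=A^{\mathbf T}+A^{\mathbf U}$ be a formal connection with $A^{\mathbf T}=t^{-1}A^{\mathbf T}_{-1}+\sum_{j=p}^\infty A^{\mathbf T}_jt^j\in\mathrm{Lie}(\mathbf T)_F$ for some $p\ge0$, and $A^{\mathbf U}=\sum_{j=m}^\infty A^{\mathbf U}_jt^j\in\mathrm{Lie}(\mathbf U)_F$ for some $m\in\mathbb Z$. Let $\chi_1,\dots,\chi_l$ be the weights of $\mathbf T$ on $\mathrm{Lie}(\mathbf U)$, let $b$ be a positive integer such that $\mu:=b\,\pi(A^{\mathbf T}_{-1})\in X_*(\mathbf T)$, and put $L=\max\bigl(\{\tfrac1b\langle\mu,\chi_i\rangle\}_{i=1}^l\cup\{0\}\bigr)$. (i) Suppose that $m>L-1$. Then there exists $x\in\mathbf G(\mathcal O)$ with $x\cdot A=t^{-1}A^{\mathbf T}_{-1}$. More precisely, there exist $x_{\mathbf T}\in\mathbf T(\mathcal O)$ with $x_{\mathbf T}\equiv1\pmod{t^{p+1}}$ and $x_{\mathbf U}\in\mathbf U(\mathcal O)$ with $x_{\mathbf U}\equiv1\pmod{t^{m+1}}$ such that $(x_{\mathbf U}x_{\mathbf T})\cdot A=t^{-1}A^{\mathbf T}_{-1}$. (ii) Suppose that $m\le L-1$. The $\mathbf G(F)$-gauge equivalence class of $A$ is determined by the coefficients $A^{\mathbf T}_j$ for $-1\le j<(n+1)(|m|-1)+L$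 and $A^{\mathbf U}_j$ for $m\le j<n(|m|-1)+L$. More precisely, suppose that there are another connection $B=B^{\mathbf T}+B^{\mathbf U}$ (with $B^{\mathbf T}\in\mathrm{Lie}(\mathbf T)_F$, $B^{\mathbf U}\in\mathrm{Lie}(\mathbf U)_F$) and a positive integer $k\ge n(|m|-1)+L$ with $B^{\mathbf T}\equiv A^{\mathbf T}\pmod{t^{k+|m|}}$ and $B^{\mathbf U}\equiv A^{\mathbf U}\pmod{t^k}$. Then there exists $x\in\mathbf G(\mathcal O)$ with $x\equiv1\pmod{t^{k-n|m|+n+1}}$ such that $x\cdot A=B$.
   Context: $\mathbf k$ is an algebraically closed field of characteristic $0$; $\mathcal O=\mathbf k[[t]]$, $F=\mathbf k((t))$; $\mathfrak g=\mathrm{Lie}(\mathbf G)=\mathrm{Lie}(\mathbf T)\oplus\mathrm{Lie}(\mathbf U)$; a subscript $F$ or $\mathcal O$ on a Lie algebra denotes base change from $\mathbf k$. A connection is an element of $\mathfrak g_F$. The gauge action of $\mathbf G(F)$ on $\mathfrak g_F$ is $x\cdot A=\mathrm{Ad}(x)A+\frac{dx}{dt}x^{-1}$ (computed in any faithful representation). Congruences mod $t^k$ of connections are modulo $t^k\mathfrak g_{\mathcal O}$; for $x\in\mathbf G(\mathcal O)$, $x\equiv1\pmod{t^k}$ means $x\mapsto1$ in $\mathbf G(\mathcal O/t^k)$. Fix a $\mathbb Q$-linear map $\pi:\mathbf k\to\mathbb Q$ with $\pi(1)=1$, extended to $\pi:\mathrm{Lie}(\mathbf T)\cong X_*(\mathbf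 T)\otimes\mathbf k\to X_*(\mathbf T)\otimes\mathbb Q$, where $X_*(\mathbf T)$ is the cocharacter lattice; $\langle-,-\rangle$ is the pairing of cocharacters and characters. The weights $\chi_i$ are the characters in the weight decomposition $\mathrm{Lie}(\mathbf U)=\bigoplus_{i=1}^l\mathfrak u_{\chi_i}$ under the adjoint action of $\mathbf T$. The nilpotency class is the length of the upper central series normalized so that commutative unipotent groups have class $0$, and a noncommutative $\mathbf U$ has class one more than $\mathbf U/Z_{\mathbf U}$, where $Z_{\mathbf U}$ is the center of $\mathbf U$.
   Formalization: Part (ii) is stated under the extra hypothesis that m ≠ 0 or n = 0: for m = 0 < n the asserted congruence x ≡ 1 (mod t^{k-n|m|+n+1}) with x·A = B fails as printed; such an A is covered by taking m = -1. *)

(* Defs.v *)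
From HB Require Import structures.
From mathcomp Require Import all_boot all_order all_algebra.
From mathcomp Require Import mpoly.
From mathcomp Require Import zify.
From mathcomp Require Import boolp classical_sets.

Set Implicit Arguments.
Unset Strict Implicit.
Unset Printing Implicit Defensive.

Import Order.TTheory GRing.Theory Num.Theory.
Local Open Scope ring_scope.

(* Formal power series k[[t]] and formal Laurent series k((t)).               *)

Record pseries (k : Type) := PSeries { pcoef : nat -> k }.

Lemma pseriesP (k : Type) (f g : pseries k) :
  pcoef f =1 pcoef g -> f = g.
Proof. by case: f g => [f] [g] /= /funext ->. Qed.

HB.instance Definition _ (k : Type) := gen_eqMixin (pseries k).
HB.instance Definition _ (k : Type) := gen_choiceMixin (pseries k).

Section PSeriesRing.
Variable k : fieldType.
Implicit Types (f g h : pseries k) (a b : k).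

Definition ps_zero : pseries k := PSeries (fun=> 0).
Definition ps_opp f := PSeries (fun n => - pcoef f n).
Definition ps_add f g := PSeries (fun n => pcoef f n + pcoef g n).
Definition ps_one : pseries k := PSeries (fun n => (n == 0)%:R).
Definition ps_mul f g :=
  PSeries (fun n => \sum_(i < n.+1) pcoef f i * pcoef g (n - i)).
Definition ps_scale a f := PSeries (fun n => a * pcoef f n).

Fact ps_addA : associative ps_add.
Proof. by move=> f g h; apply: pseriesP => n; apply: addrA. Qed.
Fact ps_addC : commutative ps_add.
Proof. by move=> f g; apply: pseriesP => n; apply: addrC. Qed.
Fact ps_add0 : left_id ps_zero ps_add.
Proof. by move=> f; apply: pseriesP => n; apply: add0r. Qed.
Fact ps_addN : left_inverse ps_zero ps_opp ps_add.
Proof. by move=> f; apply: pseriesP => n; apply: addNr. Qed.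

HB.instance Definition _ :=
  GRing.isZmodule.Build (pseries k) ps_addA ps_addC ps_add0 ps_addN.

Definition ps_trunc m f : {poly k} := \poly_(i < m) pcoef f i.

Lemma ps_mul_trunc m n f g : (n < m)%N ->
  pcoef (ps_mul f g) n = (ps_trunc m f * ps_trunc m g)`_n.
Proof.
move=> lt_nm; rewrite coefM; apply: eq_bigr => i _.
have le_in : (i <= n)%N by rewrite -ltnS.
by rewrite !coef_poly !(leq_ltn_trans _ lt_nm) ?leq_subr.
Qed.

Lemma coefM_trunc n (p q p' q' : {poly k}) :
    (forall i, (i <= n)%N -> p`_i = p'`_i) ->
    (forall i, (i <= n)%N -> q`_i = q'`_i) ->
  (p * q)`_n = (p' * q')`_n.
Proof.
move=> eq_p eq_q; rewrite !coefM; apply: eq_bigr => i _.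
by rewrite eq_p -1?ltnS// eq_q// leq_subr.
Qed.

Lemma ps_trunc_mul m f g i : (i < m)%N ->
  (ps_trunc m (ps_mul f g))`_i = (ps_trunc m f * ps_trunc m g)`_i.
Proof. by move=> lt_im; rewrite coef_poly lt_im (ps_mul_trunc _ _ lt_im). Qed.

Fact ps_mulA : associative ps_mul.
Proof.
move=> f g h; apply: pseriesP => n; rewrite !(ps_mul_trunc _ _ (ltnSn n)).
transitivity (ps_trunc n.+1 f * (ps_trunc n.+1 g * ps_trunc n.+1 h))`_n.
  by apply: coefM_trunc => // i le_in; rewrite ps_trunc_mul.
rewrite mulrA; apply/esym; apply: coefM_trunc => // i le_in.
by rewrite ps_trunc_mul.
Qed.

Fact ps_mulC : commutative ps_mul.
Proof.
by move=> f g; apply: pseriesP => n; rewrite !(ps_mul_trunc _ _ (ltnSn n)) mulrC.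
Qed.

Fact ps_mul1 : left_id ps_one ps_mul.
Proof.
move=> f; apply: pseriesP => n /=; rewrite big_ord_recl /= mul1r subn0.
by rewrite big1 ?addr0// => i _; rewrite mul0r.
Qed.

Fact ps_mulDl : left_distributive ps_mul ps_add.
Proof.
move=> f g h; apply: pseriesP => n /=; rewrite -big_split /=.
by apply: eq_bigr => i _; rewrite mulrDl.
Qed.

Fact ps_one_neq0 : ps_one != 0.
Proof.
by apply/eqP => /(congr1 (fun f => pcoef f 0)) /eqP /=; rewrite oner_eq0.
Qed.

HB.instance Definition _ := GRing.Zmodule_isComNzRing.Build (pseries k)
  ps_mulA ps_mulC ps_mul1 ps_mulDl ps_one_neq0.

Fact ps_scaleA a b f : ps_scale a (ps_scale b f) = ps_scale (a * b) f.
Proof. by apply: pseriesP => n /=; rewrite mulrA. Qed.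
Fact ps_scale1 : left_id 1 ps_scale.
Proof. by move=> f; apply: pseriesP => n /=; rewrite mul1r. Qed.
Fact ps_scaleDr : right_distributive ps_scale +%R.
Proof. by move=> a f g; apply: pseriesP => n /=; rewrite mulrDr. Qed.
Fact ps_scaleDl f : {morph ps_scale^~ f : a b / a + b}.
Proof. by move=> a b; apply: pseriesP => n /=; rewrite mulrDl. Qed.

HB.instance Definition _ := GRing.Zmodule_isLmodule.Build k (pseries k)
  ps_scaleA ps_scale1 ps_scaleDr ps_scaleDl.

Fact ps_scaleAl a f g : a *: (f * g) = (a *: f) * g.
Proof.
apply: pseriesP => n /=; rewrite mulr_sumr.
by apply: eq_bigr => i _; rewrite mulrA.
Qed.

HB.instance Definition _ :=
  GRing.Lmodule_isLalgebra.Build k (pseries k) ps_scaleAl.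
HB.instance Definition _ :=
  GRing.Lalgebra_isComAlgebra.Build k (pseries k).

Lemma pcoef0 n : pcoef (0 : pseries k) n = 0. Proof. by []. Qed.
Lemma pcoef1 n : pcoef (1 : pseries k) n = (n == 0)%:R. Proof. by []. Qed.
Lemma pcoefN f n : pcoef (- f) n = - pcoef f n. Proof. by []. Qed.
Lemma pcoefD f g n : pcoef (f + g) n = pcoef f n + pcoef g n.
Proof. by []. Qed.
Lemma pcoefZ a f n : pcoef (a *: f) n = a * pcoef f n. Proof. by []. Qed.
Lemma pcoefM f g n :
  pcoef (f * g) n = \sum_(i < n.+1) pcoef f i * pcoef g (n - i).
Proof. by []. Qed.

Lemma pcoef_sum I (r : seq I) (P : pred I) (F : I -> pseries k) n :
  pcoef (\sum_(i <- r | P i) F i) n = \sum_(i <- r | P i) pcoef (F i) n.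
Proof.
elim: r => [|i r IHr]; first by rewrite !big_nil.
by rewrite !big_cons; case: ifP => // _; rewrite pcoefD IHr.
Qed.

Lemma pcoefX_small f i n :
  pcoef f 0 = 0 -> (n < i)%N -> pcoef (f ^+ i) n = 0.
Proof.
move=> f0; elim: i n => // i IHi n lt_ni; rewrite exprS pcoefM.
rewrite big1 // => -[[|j] /= lt_jn] _; first by rewrite f0 mul0r.
by rewrite IHi ?mulr0 //; lia.
Qed.

Definition ps_unit : pred (pseries k) := [pred f | pcoef f 0 != 0].

(* geometric series for 1 / (c (1 - v)) where c = f(0) and v = 1 - f / c *)
Definition ps_geom (v : pseries k) :=
  PSeries (fun n => \sum_(i < n.+1) pcoef (v ^+ i) n).
Definition ps_inv f :=
  if ps_unit f then (pcoef f 0)^-1 *: ps_geom (1 - (pcoef f 0)^-1 *: f) else f.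

Lemma ps_geomP v : pcoef v 0 = 0 -> (1 - v) * ps_geom v = 1.
Proof.
move=> v0; apply: pseriesP => n.
have -> : pcoef ((1 - v) * ps_geom v) n =
          pcoef ((1 - v) * \sum_(i < n.+1) v ^+ i) n.
  rewrite !pcoefM; apply: eq_bigr => i _; congr (_ * _).
  rewrite pcoef_sum /= (big_ord_widen n.+1 (fun j => pcoef (v ^+ j) (n - i))).
    rewrite big_mkcond /=; apply: eq_bigr => j _.
    by case: ltnP => // lt_j; rewrite pcoefX_small.
  by rewrite ltnS leq_subr.
have -> : (1 - v) * \sum_(i < n.+1) v ^+ i = 1 - v ^+ n.+1.
  by apply: oppr_inj; rewrite -mulNr !opprB subrX1.
by rewrite pcoefD pcoefN (pcoefX_small v0 (ltnSn n)) subr0.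
Qed.

Fact ps_mulVx : {in ps_unit, left_inverse 1 ps_inv *%R}.
Proof.
move=> f f0; rewrite /ps_inv -topredE /= in f0 *.
rewrite /ps_inv /= f0 mulrC -scalerAr scalerAl.
set g := _ *: f; rewrite -[g in g * _](subKr 1) ps_geomP //.
by rewrite pcoefD pcoefN pcoefZ pcoef1 mulVf ?subrr.
Qed.

Fact ps_unitPl f g : g * f = 1 -> f \in ps_unit.
Proof.
move=> /(congr1 (fun h => pcoef h 0)) /=; rewrite big_ord_recl big_ord0 addr0 /=.
move=> gf1; rewrite -topredE /=; apply/eqP => f0.
by move/eqP: gf1; rewrite f0 mulr0 eq_sym oner_eq0.
Qed.

Fact ps_inv_out : {in [predC ps_unit], ps_inv =1 id}.
Proof.
by move=> f /negbTE nf; rewrite /ps_inv ifN //; apply/negbT.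
Qed.

HB.instance Definition _ := GRing.ComNzRing_hasMulInverse.Build (pseries k)
  ps_mulVx ps_unitPl ps_inv_out.

End PSeriesRing.

Record laurent (k : nmodType) := Laurent {
  lcoef :> int -> k;
  lcoef_bounded : exists N : nat, forall j : int, j < - N%:Z -> lcoef j = 0
}.

Lemma laurentP (k : nmodType) (f g : laurent k) : f =1 g -> f = g.
Proof.
case: f g => [f Pf] [g Pg] /= /funext eq_fg; case: g / eq_fg in Pg *.
by congr Laurent; apply: Prop_irrelevance.
Qed.

HB.instance Definition _ (k : nmodType) := gen_eqMixin (laurent k).
HB.instance Definition _ (k : nmodType) := gen_choiceMixin (laurent k).

Section LaurentField.
Variable k : fieldType.
Implicit Types (f g h : laurent k) (u v : pseries k) (a b : k) (N M : nat).

Definition lbounded N f := forall j : int, j < - N%:Z -> f j = 0.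

Lemma lbounded_leq N M f : (N <= M)%N -> lbounded N f -> lbounded M f.
Proof. by move=> le_NM fN j lt_j; apply: fN; lia. Qed.

Definition lbnd f : nat := projT1 (cid (lcoef_bounded f)).
Lemma lbndP f : lbounded (lbnd f) f.
Proof. by rewrite /lbnd; case: cid. Qed.

(* lshift N u = t^-N u, and psh N f is the part of t^N f in k[[t]] *)
Fact lshift_subproof N u : exists M : nat, forall j : int, j < - M%:Z ->
  (if 0 <= j + N%:Z then pcoef u (absz (j + N%:Z)) else 0) = 0.
Proof. by exists N => j lt_j; case: ifP => // le0; lia. Qed.
Definition lshift N u := Laurent (lshift_subproof N u).
Definition psh N f := PSeries (fun n => f (n%:Z - N%:Z)).

Lemma lshiftE N u (j : int) : lshift N u j =
  if 0 <= j + N%:Z then pcoef u (absz (j + N%:Z)) else 0.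
Proof. by []. Qed.

Lemma lshift_bounded N u : lbounded N (lshift N u).
Proof. by move=> j lt_j; rewrite lshiftE; case: ifP => // le0; lia. Qed.

Lemma pshK N f : lbounded N f -> lshift N (psh N f) = f.
Proof.
move=> fN; apply: laurentP => j; rewrite lshiftE /=.
case: ifP => [le0|/negbT lt0]; last by rewrite fN //; lia.
by congr (f _); lia.
Qed.

Lemma lshiftK N u : psh N (lshift N u) = u.
Proof.
apply: pseriesP => n; rewrite /= ifT; last lia.
by congr (pcoef u _); lia.
Qed.

Definition psX (d : nat) : pseries k := PSeries (fun n => (n == d)%:R).

Lemma pcoef_psXM d u n :
  pcoef (psX d * u) n = if (d <= n)%N then pcoef u (n - d) else 0.
Proof.
rewrite pcoefM /=; case: leqP => [le_dn|lt_nd]; last first.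
  rewrite big1 // => i _; rewrite (_ : (_ == _) = false) ?mul0r //.
  by apply/eqP => eid; have := ltn_ord i; lia.
have lt_d : (d < n.+1)%N by [].
rewrite (bigD1 (Ordinal lt_d)) //= eqxx mul1r big1 ?addr0 // => i ne.
by rewrite -[(_ == _)]/(i == Ordinal lt_d) (negbTE ne) mul0r.
Qed.

Lemma psh_addn N d f : lbounded N f -> psh (N + d) f = psX d * psh N f.
Proof.
move=> fN; apply: pseriesP => n; rewrite pcoef_psXM /=.
by case: leqP => [le_dn|lt_nd]; [congr (f _); lia | rewrite fN //; lia].
Qed.

Lemma lshift_addn N d u : lshift (N + d) (psX d * u) = lshift N u.
Proof.
apply: laurentP => j; rewrite !lshiftE pcoef_psXM.
case: ifP => [le1|/negbT lt1]; case: ifP => [le0|/negbT lt0] //.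
- by rewrite ifT; [congr (pcoef u _)|]; lia.
- by rewrite ifF //; lia.
- by lia.
Qed.

Lemma psXD (d e : nat) : psX (d + e)%N = psX d * psX e.
Proof.
apply: pseriesP => n; rewrite pcoef_psXM /=.
rewrite (_ : (n == _) = (d <= n) && (n - d == e))%N; last by lia.
by case: leqP.
Qed.

Fact laurent_zero_subproof :
  exists N : nat, forall j : int, j < - N%:Z -> 0 = 0 :> k.
Proof. by exists 0. Qed.
Definition laurent_zero := Laurent laurent_zero_subproof.

Fact laurent_opp_subproof f :
  exists N : nat, forall j : int, j < - N%:Z -> - f j = 0.
Proof. by exists (lbnd f) => j lt_j; rewrite lbndP ?oppr0. Qed.
Definition laurent_opp f := Laurent (laurent_opp_subproof f).

Fact laurent_add_subproof f g :
  exists N : nat, forall j : int, j < - N%:Z -> f j + g j = 0.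
Proof.
by exists (lbnd f + lbnd g) => j lt_j; rewrite !lbndP ?addr0 //; lia.
Qed.
Definition laurent_add f g := Laurent (laurent_add_subproof f g).

Fact laurent_scale_subproof a f :
  exists N : nat, forall j : int, j < - N%:Z -> a * f j = 0.
Proof. by exists (lbnd f) => j lt_j; rewrite lbndP ?mulr0. Qed.
Definition laurent_scale a f := Laurent (laurent_scale_subproof a f).

Definition laurent_one := lshift 0 1.
Definition laurent_mul f g :=
  lshift (lbnd f + lbnd g) (psh (lbnd f) f * psh (lbnd g) g).

Lemma laurent_mulE N M f g : lbounded N f -> lbounded M g ->
  laurent_mul f g = lshift (N + M) (psh N f * psh M g).
Proof.
move=> fN gM; rewrite /laurent_mul.
set N' := lbnd f; set M' := lbnd g.
have fN' : lbounded N' f by apply: lbndP.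
have gM' : lbounded M' g by apply: lbndP.
have key A B C D (a b : laurent k) : lbounded A a -> lbounded B b ->
    psX (C + D) * (psh A a * psh B b) = psh (A + C) a * psh (B + D) b.
  by move=> aA bB; rewrite psXD mulrACA !psh_addn.
rewrite -(lshift_addn (N' + M') (N + M)) -(lshift_addn (N + M) (N' + M')).
by rewrite !key // (addnC N' N) (addnC M' M) (addnC (N' + M')%N).
Qed.

Lemma laurent_mul_bounded N M f g : lbounded N f -> lbounded M g ->
  lbounded (N + M) (laurent_mul f g).
Proof. by move=> fN gM; rewrite (laurent_mulE fN gM); apply: lshift_bounded. Qed.

Fact laurent_addA : associative laurent_add.
Proof. by move=> f g h; apply: laurentP => n; apply: addrA. Qed.
Fact laurent_addC : commutative laurent_add.
Proof. by move=> f g; apply: laurentP => n; apply: addrC. Qed.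
Fact laurent_add0 : left_id laurent_zero laurent_add.
Proof. by move=> f; apply: laurentP => n; apply: add0r. Qed.
Fact laurent_addN : left_inverse laurent_zero laurent_opp laurent_add.
Proof. by move=> f; apply: laurentP => n; apply: addNr. Qed.

HB.instance Definition _ := GRing.isZmodule.Build (laurent k)
  laurent_addA laurent_addC laurent_add0 laurent_addN.

Fact laurent_mulA : associative laurent_mul.
Proof.
move=> f g h; have [[fN gM] hP] := (@lbndP f, @lbndP g, @lbndP h).
rewrite (laurent_mulE fN (laurent_mul_bounded gM hP)).
rewrite (laurent_mulE (laurent_mul_bounded fN gM) hP).
by rewrite (laurent_mulE fN gM) (laurent_mulE gM hP) !lshiftK mulrA addnA.
Qed.

Fact laurent_mulC : commutative laurent_mul.
Proof. by move=> f g; rewrite /laurent_mul mulrC addnC. Qed.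

Fact laurent_mul1 : left_id laurent_one laurent_mul.
Proof.
move=> f; rewrite (laurent_mulE (@lshift_bounded 0 1) (@lbndP f)).
by rewrite lshiftK mul1r pshK //; apply: lbndP.
Qed.

Fact laurent_mulDl : left_distributive laurent_mul +%R.
Proof.
move=> f g h; pose N := (lbnd f + lbnd g)%N.
have fN : lbounded N f by apply: lbounded_leq (@lbndP f); apply: leq_addr.
have gN : lbounded N g by apply: lbounded_leq (@lbndP g); apply: leq_addl.
have fgN : lbounded N (f + g).
  by move=> j lt_j; rewrite -[LHS]/(f j + g j) fN // gN // addr0.
have hM := @lbndP h.
rewrite (laurent_mulE fgN hM) (laurent_mulE fN hM) (laurent_mulE gN hM).
rewrite (_ : psh N (f + g) = psh N f + psh N g) ?mulrDl; last exact: pseriesP.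
apply: laurentP => j; rewrite -[RHS]/(lshift _ _ j + lshift _ _ j) !lshiftE.
by case: ifP; rewrite ?addr0.
Qed.

Fact laurent_one_neq0 : laurent_one != 0.
Proof.
by apply/eqP => /(congr1 (fun f : laurent k => f 0)) /eqP /=; rewrite oner_eq0.
Qed.

HB.instance Definition _ := GRing.Zmodule_isComNzRing.Build (laurent k)
  laurent_mulA laurent_mulC laurent_mul1 laurent_mulDl laurent_one_neq0.

Fact laurent_scaleA a b f :
  laurent_scale a (laurent_scale b f) = laurent_scale (a * b) f.
Proof. by apply: laurentP => n /=; rewrite mulrA. Qed.
Fact laurent_scale1 : left_id 1 laurent_scale.
Proof. by move=> f; apply: laurentP => n /=; rewrite mul1r. Qed.
Fact laurent_scaleDr : right_distributive laurent_scale +%R.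
Proof. by move=> a f g; apply: laurentP => n /=; rewrite mulrDr. Qed.
Fact laurent_scaleDl f : {morph laurent_scale^~ f : a b / a + b}.
Proof. by move=> a b; apply: laurentP => n /=; rewrite mulrDl. Qed.

HB.instance Definition _ := GRing.Zmodule_isLmodule.Build k (laurent k)
  laurent_scaleA laurent_scale1 laurent_scaleDr laurent_scaleDl.

Fact laurent_scaleAl a f g : a *: (f * g) = (a *: f) * g.
Proof.
have [fN gM] := (@lbndP f, @lbndP g).
have afN : lbounded (lbnd f) (a *: f).
  by move=> j lt_j; rewrite -[LHS]/(a * f j) fN ?mulr0.
rewrite -[(a *: f) * g]/(laurent_mul _ _) (laurent_mulE afN gM).
rewrite (_ : psh _ (a *: f) = a *: psh (lbnd f) f); last exact: pseriesP.
rewrite -scalerAl; apply: laurentP => j.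
by rewrite -[LHS]/(a * (lshift _ _ j)) !lshiftE; case: ifP; rewrite ?mulr0.
Qed.

HB.instance Definition _ :=
  GRing.Lmodule_isLalgebra.Build k (laurent k) laurent_scaleAl.
HB.instance Definition _ := GRing.Lalgebra_isComAlgebra.Build k (laurent k).

Fact lmon_subproof (d : int) :
  exists N : nat, forall j : int, j < - N%:Z -> (j == d)%:R = 0 :> k.
Proof. by exists (absz d) => j lt_j; rewrite (_ : (j == d) = false) //; lia. Qed.

(* the monomial t^d *)
Definition lmon (d : int) : laurent k := Laurent (lmon_subproof d).

Lemma lmonK N d : 0 <= d + N%:Z -> lmon d = lshift N (psX (absz (d + N%:Z))).
Proof.
move=> le0; apply: laurentP => j; rewrite lshiftE /=.
case: ifP => h; last by rewrite (_ : (j == d) = false) //; lia.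
by rewrite (_ : (j == d) = (absz (j + N%:Z) == absz (d + N%:Z))) //; lia.
Qed.

Lemma laurent_has_inv f : f != 0 -> exists g, g * f = 1.
Proof.
move=> nz_f; set N := lbnd f; have fN : lbounded N f by apply: lbndP.
have ex_n : exists n, pcoef (psh N f) n != 0.
  apply: contrapT => n_ex; case/eqP: nz_f; rewrite -(pshK fN).
  apply: laurentP => j; rewrite lshiftE; case: ifP => // _.
  by apply/eqP/negPn/negP => ?; apply: n_ex; eexists; eassumption.
pose n := ex_minn ex_n.
have [fn min_n] : pcoef (psh N f) n != 0 /\
    forall i, (i < n)%N -> pcoef (psh N f) i = 0.
  rewrite /n; case: ex_minnP => i fi min_i; split=> // j lt_ji.
  by apply/eqP/negPn/negP => /min_i; rewrite leqNgt lt_ji.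
pose u : pseries k := PSeries (fun i => pcoef (psh N f) (i + n)).
have fE : psh N f = psX n * u.
  apply: pseriesP => i; rewrite pcoef_psXM.
  by case: leqP => [le_ni|/min_n] //; congr (pcoef _ _); rewrite subnK.
have uU : u \is a GRing.unit by rewrite unfold_in.
exists (lshift n (psX N * u^-1)).
rewrite -[LHS]/(laurent_mul _ _) (laurent_mulE (@lshift_bounded _ _) fN).
rewrite lshiftK fE (mulrACA (psX N)) mulVr // -psXD (addnC N).
by rewrite -[X in lshift X _](add0n (n + N)%N) lshift_addn.
Qed.

Definition laurent_inv f : laurent k :=
  if pselect (exists g, g * f = 1) is left ex then projT1 (cid ex) else f.

Definition laurent_unit : pred (laurent k) := [pred f | f != 0].

Fact laurent_mulVx : {in laurent_unit, left_inverse 1 laurent_inv *%R}.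
Proof.
move=> f; rewrite -topredE /= => /laurent_has_inv ex; rewrite /laurent_inv.
by case: pselect => [?|/(_ ex)] //; case: cid.
Qed.

Fact laurent_unitPl f g : g * f = 1 -> f \in laurent_unit.
Proof.
move=> gf1; rewrite -topredE /=; apply/eqP => f0.
by move/eqP: gf1; rewrite f0 mulr0 eq_sym oner_eq0.
Qed.

Fact laurent_inv_out : {in [predC laurent_unit], laurent_inv =1 id}.
Proof.
move=> f; rewrite -topredE /= negbK => /eqP ->; rewrite /laurent_inv.
case: pselect => // ex; exfalso; case: ex => g /eqP.
by rewrite mulr0 eq_sym oner_eq0.
Qed.

HB.instance Definition _ := GRing.ComNzRing_hasMulInverse.Build (laurent k)
  laurent_mulVx laurent_unitPl laurent_inv_out.

Fact laurent_fieldP : GRing.field_axiom (laurent k).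
Proof. by move=> f nz_f; rewrite -topredE. Qed.

HB.instance Definition _ := GRing.ComUnitRing_isField.Build (laurent k)
  laurent_fieldP.

Lemma lcoefM f g N M (j : int) : lbounded N f -> lbounded M g ->
  (f * g) j = if 0 <= j + (N + M)%:Z
    then \sum_(i < (absz (j + (N + M)%:Z)).+1) f (i%:Z - N%:Z) * g (j - (i%:Z - N%:Z))
    else 0.
Proof.
move=> fN gM; rewrite -[LHS]/(laurent_mul f g j) (laurent_mulE fN gM) lshiftE.
case: ifP => // le0; rewrite pcoefM; apply: eq_bigr => i _ /=.
by congr (_ * g _); have := ltn_ord i; lia.
Qed.

Fact laurent_deriv_subproof f :
  exists N : nat, forall j : int, j < - N%:Z -> f (j + 1) *~ (j + 1) = 0.
Proof.
by exists (lbnd f).+1 => j lt_j; rewrite lbndP ?mul0rz //; lia.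
Qed.
(* d/dt *)
Definition laurent_deriv f : laurent k := Laurent (laurent_deriv_subproof f).

(* the inclusion of k[[t]] in k((t)) *)
Definition laurent_of_pseries u : laurent k := lshift 0 u.

Fact laurent_of_pseries_is_zmod_morphism : zmod_morphism laurent_of_pseries.
Proof.
move=> u v; apply: laurentP => j.
rewrite -[RHS]/(lshift 0 u j - lshift 0 v j) !lshiftE.
by case: ifP; rewrite ?subr0.
Qed.
HB.instance Definition _ := GRing.isZmodMorphism.Build (pseries k) (laurent k)
  laurent_of_pseries laurent_of_pseries_is_zmod_morphism.

Fact laurent_of_pseries_is_monoid_morphism : monoid_morphism laurent_of_pseries.
Proof.
split=> // u v; rewrite -[RHS]/(laurent_mul _ _).
by rewrite (laurent_mulE (@lshift_bounded 0 u) (@lshift_bounded 0 v)) !lshiftK.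
Qed.
HB.instance Definition _ :=
  GRing.isMonoidMorphism.Build (pseries k) (laurent k)
  laurent_of_pseries laurent_of_pseries_is_monoid_morphism.

End LaurentField.


(* Linear algebraic groups over an algebraically closed field k of            *)
(* characteristic 0, in the classical language: Zariski-closed subgroups of   *)
(* GL_N(k).  Since char k = 0 they are reduced, so that no scheme structure   *)
(* is lost.  Polynomial functions on N x N matrices are polynomials in N * N  *)
(* variables, matched with the entries through mxvec.                         *)

Local Open Scope classical_set_scope.

Section AlgebraicGroups.
Variable k : closedFieldType.

Definition mxeval N (f : {mpoly k[N * N]}) (g : 'M[k]_N) : k :=
  f.@[fun i => mxvec g 0 i].

Definition mxevalA N (R : comAlgType k) (f : {mpoly k[N * N]})
    (g : 'M[R]_N) : R :=
  mmap (fun a : k => a%:A : R) (fun i => mxvec g 0 i) f.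

Definition linear_alggroup N (G : set 'M[k]_N) : Prop :=
  [/\ [/\ G 1%:M,
          forall g h, G g -> G h -> G (g *m h),
          forall g, G g -> G (invmx g)
        & forall g, G g -> g \in unitmx]
    & exists I : set {mpoly k[N * N]}, forall g, g \in unitmx ->
        (G g <-> forall f, I f -> mxeval f g = 0)].

Definition vanishing N (G : set 'M[k]_N) : set {mpoly k[N * N]} :=
  [set f | forall g, G g -> mxeval f g = 0].

(* G(R) for a commutative k-algebra R *)
Definition points N (G : set 'M[k]_N) (R : comUnitAlgType k) : set 'M[R]_N :=
  [set g | g \in unitmx /\ forall f, vanishing G f -> mxevalA f g = 0].

(* Lie(G): the tangent space of G at the identity matrix *)
Definition Lie N (G : set 'M[k]_N) : set 'M[k]_N :=
  [set X | forall f, vanishing G f ->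
     \sum_(i < N * N) mxeval (mderiv i f) 1%:M * mxvec X 0 i = 0].

(* the R-submodule V (x) R of 'M[R]_N, for V a subspace of 'M[k]_N *)
Definition base_change N (V : set 'M[k]_N) (R : comAlgType k) : set 'M[R]_N :=
  [set A | exists (d : nat) (c : 'I_d -> R) (X : 'I_d -> 'M[k]_N),
     (forall i, V (X i)) /\
     A = \sum_(i < d) c i *: map_mx (fun a : k => a%:A : R) (X i)].

Definition regular_on N (G : set 'M[k]_N) (phi : 'M[k]_N -> k) : Prop :=
  exists (f : {mpoly k[N * N]}) (e : nat),
    forall g, G g -> phi g = mxeval f g / \det g ^+ e.

Definition alg_hom N M (G : set 'M[k]_N) (H : set 'M[k]_M)
    (phi : 'M[k]_N -> 'M[k]_M) : Prop :=
  [/\ forall g, G g -> H (phi g),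
      forall g h, G g -> G h -> phi (g *m h) = phi g *m phi h
    & forall i j, regular_on G (fun g => phi g i j)].

Definition alg_iso N M (G : set 'M[k]_N) (H : set 'M[k]_M) : Prop :=
  exists phi psi, [/\ alg_hom G H phi, alg_hom H G psi,
    forall g, G g -> psi (phi g) = g & forall h, H h -> phi (psi h) = h].

(* G_m^r, realized as the invertible diagonal matrices of size r *)
Definition diag_torus r : set 'M[k]_r :=
  [set g | g \in unitmx /\ is_diag_mx g].

Definition torus N (T : set 'M[k]_N) : Prop :=
  linear_alggroup T /\ exists r, alg_iso (diag_torus (r := r)) T.

Definition unipotent N (U : set 'M[k]_N) : Prop :=
  linear_alggroup U /\
  forall u, U u -> exists e : nat, iter e (mulmx (u - 1%:M)) 1%:M = 0.

(* G is the internal semidirect product of T and the normal subgroup U.  In   *)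
(* characteristic 0 the bijective homomorphism T |x U -> G is then an         *)
(* isomorphism of algebraic groups.                                           *)
Definition semidirect N (G T U : set 'M[k]_N) : Prop :=
  [/\ T `<=` G, U `<=` G,
      forall g u, G g -> U u -> U (g *m u *m invmx g),
      T `&` U = [set 1%:M]
    & forall g, G g -> exists t u, [/\ T t, U u & g = t *m u]].

Fixpoint upper_central N (U : set 'M[k]_N) (i : nat) : set 'M[k]_N :=
  if i is i'.+1 then
    [set g | U g /\ forall h, U h ->
       upper_central U i' (g *m h *m invmx g *m invmx h)]
  else [set 1%:M].

(* normalized so that U has class 0 when it is commutative: n + 1 is the      *)
(* least index at which the upper central series reaches U                    *)
Definition nilpotency_class N (U : set 'M[k]_N) (n : nat) : Prop :=
  upper_central U n.+1 = U /\
  forall i, (i < n)%N -> upper_central U i.+1 <> U.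

(* Characters T -> G_m and cocharacters G_m -> T.  Only the values of a       *)
(* character on T, and of a cocharacter on k \ {0}, are meaningful.           *)
Definition character N (T : set 'M[k]_N) (chi : 'M[k]_N -> k) : Prop :=
  [/\ forall g, T g -> chi g != 0,
      forall g h, T g -> T h -> chi (g *m h) = chi g * chi h
    & regular_on T chi].

Definition laurent_poly_rep (phi : k -> k) (P : {poly k}) (e : nat) : Prop :=
  forall s, s != 0 -> phi s = P.[s] / s ^+ e.

Definition cocharacter N (T : set 'M[k]_N) (lam : k -> 'M[k]_N) : Prop :=
  [/\ forall s, s != 0 -> T (lam s),
      forall s s', s != 0 -> s' != 0 -> lam (s * s') = lam s *m lam s'
    & forall i j, exists P e, laurent_poly_rep (fun s => lam s i j) P e].

(* X = (d lam / d s)(1); the derivative of P(s) / s^e at 1 is P'(1) - e P(1)  *)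
Definition cochar_diff N (lam : k -> 'M[k]_N) (X : 'M[k]_N) : Prop :=
  forall i j, exists P e, laurent_poly_rep (fun s => lam s i j) P e /\
    X i j = P^`().[1] - e%:R * P.[1].

(* mu = \sum_i q_i lam_i in X_*(T) (x) Q, i.e., d mu = \sum_i (d q_i) lam_i   *)
(* in X_*(T) for a common denominator d (X_*(T) is torsion-free); a multiple  *)
(* n lam is s |-> lam (s ^ n), and the sum is the pointwise product           *)
Definition cochar_ratcomb N r (lam : 'I_r -> k -> 'M[k]_N) (q : 'I_r -> rat)
    (mu : k -> 'M[k]_N) : Prop :=
  exists (d : nat) (n : 'I_r -> int),
    [/\ (0 < d)%N, forall i, (n i)%:~R = d%:R * q i
      & forall s, s != 0 ->
          \big[mulmx/1%:M]_(i < r) lam i (s ^ n i) = mu (s ^+ d)].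

(* mu = b pi(X) in X_*(T) (x) Q, where pi : k -> Q is extended to             *)
(* Lie(T) = X_*(T) (x) k; here lam (x) c is c (d lam / d s)(1)                *)
Definition pi_ext_eq N (pi : k -> rat) (T : set 'M[k]_N) (b : nat)
    (X : 'M[k]_N) (mu : k -> 'M[k]_N) : Prop :=
  exists (r : nat) (lam : 'I_r -> k -> 'M[k]_N) (D : 'I_r -> 'M[k]_N)
         (c : 'I_r -> k),
    [/\ forall i, cocharacter T (lam i),
        forall i, cochar_diff (lam i) (D i),
        X = \sum_(i < r) c i *: D i
      & cochar_ratcomb lam (fun i => b%:R * pi (c i)) mu].

Definition pairing N (mu : k -> 'M[k]_N) (chi : 'M[k]_N -> k) : int :=
  xget 0 [set e : int | forall s, s != 0 -> chi (mu s) = s ^ e].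

Definition weight N (T U : set 'M[k]_N) (chi : 'M[k]_N -> k) : Prop :=
  character T chi /\
  exists X, [/\ X != 0, Lie U X
    & forall s, T s -> s *m X *m invmx s = chi s *: X].

Definition weights_of N (T U : set 'M[k]_N) l
    (chi : 'I_l -> 'M[k]_N -> k) : Prop :=
  [/\ forall i, weight T U (chi i),
      forall i j, (forall s, T s -> chi i s = chi j s) -> i = j
    & forall psi, weight T U psi ->
        exists i, forall s, T s -> psi s = chi i s].

End AlgebraicGroups.

Section Connections.
Variables (k : closedFieldType) (N : nat).

(* the coefficient A_j of t^j *)
Definition coefmx (A : 'M[laurent k]_N) (j : int) : 'M[k]_N :=
  map_mx (fun f : laurent k => f j) A.

(* t^d X *)
Definition tmx (d : int) (X : 'M[k]_N) : 'M[laurent k]_N :=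
  lmon k d *: map_mx (fun a : k => a%:A : laurent k) X.

(* A = B mod t^e.  For connections A and B in Lie(H)_F this says that A - B   *)
(* is in t^e Lie(H)_O.                                                        *)
Definition eqmodt (e : int) (A B : 'M[laurent k]_N) : Prop :=
  forall j : int, j < e -> coefmx A j = coefmx B j.

Definition mxF (x : 'M[pseries k]_N) : 'M[laurent k]_N :=
  map_mx (@laurent_of_pseries k) x.

Definition gauge (x A : 'M[laurent k]_N) : 'M[laurent k]_N :=
  x *m A *m invmx x + map_mx (@laurent_deriv k) x *m invmx x.

End Connections.

(* Main.v *)
(* Write V_i for the Lie algebra of the i-th upper central subgroup of U.     *)
(* Differentiating the group commutator twice gives [Lie U, V_(i+1)] in V_i,  *)
(* and each V_i is stable under Lie T.  A solution x of x' = C x, x(0) = 1,   *)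
(* with C in V_(i+1)[[t]] lies in U(k[[t]]), and modulo V_i its gauge action  *)
(* changes the coefficient of t^n by C_n + [C_n, D] / (n + 1), where D / t is *)
(* the polar part.  So two connections congruent modulo V_(i+1) can be made   *)
(* congruent modulo V_i as soon as no integer above their order of contact is *)
(* an eigenvalue of ad D on Lie U; iterating over i proves the claim.         *)
(* The commuting operators Ad(g), g in T, have a common eigenvector in any    *)
(* eigenspace of ad D, so each eigenvalue is the differential at D of a       *)
(* weight chi, and pi sends it to <mu, chi> / b <= L.                         *)
Require Import Defs.
From HB Require Import structures.
From mathcomp Require Import all_boot all_order all_algebra.
From mathcomp Require Import mpoly.
From mathcomp Require Import zify ring lra.
From mathcomp Require Import boolp classical_sets.
Set Implicit Arguments.
Unset Strict Implicit.
Unset Printing Implicit Defensive.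
Import Order.TTheory GRing.Theory Num.Theory.
Local Open Scope ring_scope.

(** * Matrices of power series *)

(** Gauge transformations are built from their logarithmic derivative rather than from exponentials.
    For a matrix C over k[[t]], [ode_solution] gives x with x(0) = 1 and x' = C x. If the
    coefficients of C lie in Lie S, then x is a k[[t]]-point of the group S
    ([integral_curve_points]); if C is divisible by t^e, then x = 1 mod t^(e+1).

    Torus part: Lie T is abelian, so conjugation by a solution with C in (Lie T)[[t]] fixes A^T, and
    the choice C = B^T - A^T carries A^T to B^T as soon as the polar parts agree ([torus_gauge]).
    This reduces everything to connections D/t + A with A in Lie U, where D is the residue.

    Unipotent part: [descent_step] moves A towards B by one layer of the upper central series.
    Modulo the next layer one has to solve C_n + [C_n, D]/(n+1) = B_n - A_n, which is possible when
    n+1 is not an eigenvalue of ad D. Conjugating A by x = 1 mod t^(K+1) disturbs it only from order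
    K+1+m on, so a layer costs at most max(0, -m-1) orders of contact. [gauge_descent] runs through
    the n+1 layers; the last one needs no contact afterwards, so at most n losses count.
    [eigenvalue_le_weights] shows that an eigenvalue n+1 of ad D on Lie U is at most L.

    In part (i), m is nonnegative, nothing is lost, and the target is B^U = 0. In part (ii),
    n(|m|-1) orders are lost and the remaining K - n(|m|-1) is at least L, so no eigenvalue
    obstructs. [semidirect_gauge] combines the torus and unipotent parts. *)

Lemma invmx_mul (R : comUnitRingType) n (g h : 'M[R]_n) :
  g \in unitmx -> h \in unitmx -> invmx (g *m h) = invmx h *m invmx g.
Proof.
move=> ug uh; have ugh : g *m h \in unitmx by rewrite unitmx_mul ug uh.
rewrite -[RHS](mulKmx ugh) (_ : _ *m (_ *m invmx g) = 1%:M) ?mulmx1 //.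
by rewrite mulmxA mulmxK // mulmxV.
Qed.

Section SeriesMatrices.
Variable k : fieldType.

Definition cmx m n (X : 'M[k]_(m, n)) : 'M[pseries k]_(m, n) :=
  map_mx (in_alg (pseries k)) X.
Definition mcoef m n (x : 'M[pseries k]_(m, n)) (j : nat) : 'M[k]_(m, n) :=
  map_mx (fun f => pcoef f j) x.

Lemma mcoefP m n (x y : 'M[pseries k]_(m, n)) : mcoef x =1 mcoef y -> x = y.
Proof.
move=> exy; apply/matrixP => i j; apply: pseriesP => a.
by have /matrixP/(_ i j) := exy a; rewrite !mxE.
Qed.

Lemma mcoef0 m n j : mcoef (0 : 'M_(m, n)) j = 0.
Proof. by apply/matrixP => a b; rewrite !mxE. Qed.
Lemma mcoefD m n (x y : 'M_(m, n)) j : mcoef (x + y) j = mcoef x j + mcoef y j.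
Proof. by apply/matrixP => a b; rewrite !mxE. Qed.
Lemma mcoefN m n (x : 'M_(m, n)) j : mcoef (- x) j = - mcoef x j.
Proof. by apply/matrixP => a b; rewrite !mxE. Qed.
Lemma mcoefB m n (x y : 'M_(m, n)) j : mcoef (x - y) j = mcoef x j - mcoef y j.
Proof. by rewrite mcoefD mcoefN. Qed.

Lemma mcoefM m n p (x : 'M_(m, n)) (y : 'M_(n, p)) j :
  mcoef (x *m y) j = \sum_(i < j.+1) mcoef x i *m mcoef y (j - i).
Proof.
apply/matrixP => a b; rewrite summxE !mxE pcoef_sum.
under eq_bigr do rewrite pcoefM.
rewrite exchange_big; apply: eq_bigr => i _; rewrite [RHS]mxE.
by apply: eq_bigr => c _; rewrite !mxE.
Qed.

Lemma mcoef_cmx m n (X : 'M_(m, n)) j : mcoef (cmx X) j = if j == 0%N then X else 0.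
Proof.
apply/matrixP => a b; rewrite !mxE pcoefZ pcoef1.
by case: eqP; rewrite ?mulr1 ?mulr0 ?mxE.
Qed.

Lemma cmx1 n : cmx 1%:M = 1%:M :> 'M_n.
Proof. by rewrite /cmx map_mx1. Qed.
Lemma cmxM m n p (X : 'M_(m, n)) (Y : 'M_(n, p)) : cmx (X *m Y) = cmx X *m cmx Y.
Proof. exact: map_mxM. Qed.

Lemma mcoef_cmxl m n p (X : 'M_(m, n)) (y : 'M_(n, p)) j :
  mcoef (cmx X *m y) j = X *m mcoef y j.
Proof.
rewrite mcoefM big_ord_recl subn0 mcoef_cmx eqxx big1 ?addr0 // => i _.
by rewrite mcoef_cmx mul0mx.
Qed.

Lemma mcoef_cmxr m n p (x : 'M_(m, n)) (Y : 'M_(n, p)) j :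
  mcoef (x *m cmx Y) j = mcoef x j *m Y.
Proof.
rewrite mcoefM big_ord_recr /= subnn mcoef_cmx eqxx big1 ?add0r // => i _.
by rewrite mcoef_cmx subn_eq0 leqNgt ltn_ord mulmx0.
Qed.

Lemma mcoefM0 m n p (x : 'M_(m, n)) (y : 'M_(n, p)) :
  mcoef (x *m y) 0 = mcoef x 0 *m mcoef y 0.
Proof. by rewrite mcoefM big_ord1. Qed.

Lemma mcoef1 n j : mcoef (1%:M : 'M_n) j = if j == 0%N then 1%:M else 0.
Proof. by rewrite -cmx1 mcoef_cmx. Qed.

(** Evaluation at t = 0, packaged as a ring morphism so that determinants and polynomial values
    commute with it. *)
Definition ps_at0 (f : pseries k) : k := pcoef f 0.
Fact ps_at0_is_zmod_morphism : zmod_morphism ps_at0.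
Proof. by []. Qed.
Fact ps_at0_is_monoid_morphism : monoid_morphism ps_at0.
Proof. by split=> // f g; rewrite /ps_at0 pcoefM big_ord1. Qed.
HB.instance Definition _ := GRing.isZmodMorphism.Build (pseries k) k
  ps_at0 ps_at0_is_zmod_morphism.
HB.instance Definition _ := GRing.isMonoidMorphism.Build (pseries k) k
  ps_at0 ps_at0_is_monoid_morphism.

Lemma unitps_mx n (x : 'M[pseries k]_n) : mcoef x 0 = 1%:M -> x \in unitmx.
Proof.
move=> x0; rewrite unitmxE; change (ps_at0 (\det x) != 0).
by rewrite -det_map_mx -[map_mx _ x]/(mcoef x 0) x0 det1 oner_eq0.
Qed.

Lemma mcoef_inv0 n (x : 'M[pseries k]_n) :
  mcoef x 0 = 1%:M -> mcoef (invmx x) 0 = 1%:M.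
Proof.
move=> x0; have := mulVmx (unitps_mx x0) => /(congr1 (fun y => mcoef y 0)).
by rewrite mcoefM0 x0 mulmx1 -cmx1 mcoef_cmx.
Qed.

Definition ps_deriv (f : pseries k) : pseries k :=
  PSeries (fun n => pcoef f n.+1 *+ n.+1).

Fact ps_deriv_is_zmod_morphism : zmod_morphism ps_deriv.
Proof. by move=> f g; apply: pseriesP => n /=; rewrite mulrnBl. Qed.
HB.instance Definition _ := GRing.isZmodMorphism.Build (pseries k) (pseries k)
  ps_deriv ps_deriv_is_zmod_morphism.

Lemma ps_derivM f g : ps_deriv (f * g) = ps_deriv f * g + f * ps_deriv g.
Proof.
apply: pseriesP => n; rewrite -[LHS]/(pcoef (f * g) n.+1 *+ n.+1).
(* A fixed coefficient only sees truncations, so the Leibniz rule for polynomials suffices. *)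
rewrite (ps_mul_trunc _ _ (ltnSn n.+1)) -coef_deriv derivM coefD.
rewrite -[RHS]/(pcoef (ps_mul _ g) n + pcoef (ps_mul f _) n).
rewrite !(ps_mul_trunc _ _ (ltnSn n)).
congr (_ + _); apply: coefM_trunc => i le_in.
- by rewrite coef_deriv !coef_poly !ltnS le_in.
- by rewrite !coef_poly !ltnS le_in leqW.
- by rewrite !coef_poly !ltnS le_in leqW.
- by rewrite coef_deriv !coef_poly !ltnS le_in.
Qed.

Lemma ps_deriv_alg a : ps_deriv a%:A = 0.
Proof. by apply: pseriesP => n /=; rewrite mulr0 mul0rn. Qed.

Definition mxD m n (x : 'M[pseries k]_(m, n)) := map_mx ps_deriv x.

Lemma mxDM m n p (x : 'M_(m, n)) (y : 'M_(n, p)) :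
  mxD (x *m y) = mxD x *m y + x *m mxD y.
Proof.
apply/matrixP => a b; rewrite !mxE raddf_sum -big_split; apply: eq_bigr => c _.
by rewrite /= !mxE ps_derivM.
Qed.

Lemma mxD_cmx m n (X : 'M_(m, n)) : mxD (cmx X) = 0.
Proof. by apply/matrixP => a b; rewrite !mxE ps_deriv_alg. Qed.
Lemma mxD1 n : mxD (1%:M : 'M_n) = 0.
Proof. by rewrite -cmx1 mxD_cmx. Qed.

Lemma mcoef_mxD m n (x : 'M_(m, n)) j : mcoef (mxD x) j = j.+1%:R *: mcoef x j.+1.
Proof. by apply/matrixP => a b; rewrite !mxE mulr_natl. Qed.

(** The chain rule: both sides are additive in f and obey the Leibniz rule, so constants and
    variables are enough. *)
Lemma ps_deriv_mmap n (x : 'I_n -> pseries k) (f : {mpoly k[n]}) :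
  ps_deriv (mmap (in_alg (pseries k)) x f) =
  \sum_i mmap (in_alg (pseries k)) x f^`M(i) * ps_deriv (x i).
Proof.
pose ev := mmap (in_alg (pseries k)) x.
pose P f := ps_deriv (ev f) = \sum_i ev f^`M(i) * ps_deriv (x i).
have PM g h : P g -> P h -> P (g * h).
  rewrite /P /ev rmorphM ps_derivM => -> ->.
  rewrite mulr_suml mulr_sumr -big_split; apply: eq_bigr => i _.
  by rewrite mderivM mmapD !rmorphM /=; ring.
have PC c : P c%:MP.
  rewrite /P /ev mmapC ps_deriv_alg big1 // => i _.
  by rewrite mderivC mmap0 mul0r.
have PX i : P 'X_i.
  rewrite /P /ev mmapX mmap1U (bigD1 i) //= big1 ?addr0 => [|j ne_ji].
    by rewrite mderivX mnm1E eqxx scale1r -{1}[U_(i)%MM]add0m addmK mmapX mmap11 mul1r.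
  by rewrite mderivX mnm1E eq_sym (negbTE ne_ji) scale0r mmap0 mul0r.
have PE e g : P g -> P (g ^+ e).
  by move=> Pg; elim: e => [|e IHe]; rewrite ?expr0 ?exprS; [apply: (PC 1)|apply: PM].
elim/mpolyind: f => [|c m p _ _ IHp]; first exact: (PC 0).
have PXm : P 'X_[m].
  rewrite mpolyXE_id; elim/big_rec: _ => [|i g _ Pg]; first exact: (PC 1).
  by apply: PM => //; apply: PE.
have := PM _ _ (PC c) PXm; rewrite /P /ev mul_mpolyC => Pc.
rewrite mmapD raddfD /= Pc IHp -big_split; apply: eq_bigr => i _.
by rewrite mderivD mmapD mulrDl.
Qed.

End SeriesMatrices.

(** * Subspaces of matrices and the Lie bracket *)

Section Subspaces.
Variables (k : fieldType) (m n : nat).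
Implicit Types (V : set 'M[k]_(m, n)) (X Y : 'M[k]_(m, n)).

(** Lie algebras arrive as predicates on matrices, so subspaces are kept as sets; [subspace_vspace]
    recovers a finite-dimensional space when dimensions matter. *)
Definition subspace V : Prop :=
  V 0 /\ forall a X Y, V X -> V Y -> V (a *: X + Y).

Lemma subspaceZ V a X : subspace V -> V X -> V (a *: X).
Proof. by case=> V0 VD VX; rewrite -[_ *: X]addr0; apply: VD. Qed.
Lemma subspaceD V X Y : subspace V -> V X -> V Y -> V (X + Y).
Proof. by case=> _ VD VX VY; rewrite -[X]scale1r; apply: VD. Qed.
Lemma subspaceN V X : subspace V -> V X -> V (- X).
Proof. by move=> sV VX; rewrite -scaleN1r; apply: subspaceZ. Qed.
Lemma subspaceB V X Y : subspace V -> V X -> V Y -> V (X - Y).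
Proof. by move=> sV VX VY; apply: subspaceD => //; apply: subspaceN. Qed.
Lemma subspace_sum V I (r : seq I) (P : pred I) (F : I -> 'M_(m, n)) :
  subspace V -> (forall i, P i -> V (F i)) -> V (\sum_(i <- r | P i) F i).
Proof.
move=> sV VF; elim/big_rec: _ => [|i X Pi VX]; first by case: sV.
by apply: subspaceD => //; apply: VF.
Qed.

Lemma subspaceZI V a X : subspace V -> a != 0 -> V (a *: X) -> V X.
Proof.
by move=> sV a0 /(subspaceZ a^-1 sV); rewrite scalerA mulVf // scale1r.
Qed.

Lemma subspace_zero : subspace [set 0 : 'M[k]_(m, n)].
Proof. by split=> // a X Y /= -> ->; rewrite scaler0 addr0. Qed.

End Subspaces.

Definition bracket (k : pzRingType) N (X Y : 'M[k]_N) : 'M[k]_N :=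
  X *m Y - Y *m X.

Definition subalgebra (k : fieldType) N (V : set 'M[k]_N) : Prop :=
  subspace V /\ forall X Y, V X -> V Y -> V (bracket X Y).

Section Bracket.
Variables (R : comPzRingType) (N : nat).
Implicit Types X Y Z : 'M[R]_N.

Lemma bracket0r X : bracket X 0 = 0.
Proof. by rewrite /bracket mulmx0 mul0mx subrr. Qed.
Lemma bracket0l X : bracket 0 X = 0.
Proof. by rewrite /bracket mulmx0 mul0mx subrr. Qed.
Lemma bracketDr X Y Z : bracket X (Y + Z) = bracket X Y + bracket X Z.
Proof. by rewrite /bracket mulmxDl mulmxDr opprD addrACA. Qed.
Lemma bracketZr a X Y : bracket X (a *: Y) = a *: bracket X Y.
Proof. by rewrite /bracket -scalemxAl -scalemxAr scalerBr. Qed.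
Lemma bracketZl a X Y : bracket (a *: X) Y = a *: bracket X Y.
Proof. by rewrite /bracket -scalemxAl -scalemxAr scalerBr. Qed.
Lemma bracketC X Y : bracket X Y = - bracket Y X.
Proof. by rewrite /bracket opprB. Qed.

End Bracket.

(** * The equation x' = C x and conjugation by its solutions *)

Section ODE.
Variables (k : fieldType) (N : nat).
Implicit Types (x y A C : 'M[pseries k]_N) (X Y D : 'M[k]_N) (V W : set 'M[k]_N).

Definition zero_below m n (e : nat) (A : 'M[pseries k]_(m, n)) :=
  forall j, (j < e)%N -> mcoef A j = 0.

Lemma zero_below_mull e A x : zero_below e A -> zero_below e (x *m A).
Proof.
move=> A0 j lt_je; rewrite mcoefM big1 // => i _.
by rewrite A0 ?mulmx0 //; apply: leq_ltn_trans lt_je; apply: leq_subr.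
Qed.
Lemma zero_below_mulr e A x : zero_below e A -> zero_below e (A *m x).
Proof.
move=> A0 j lt_je; rewrite mcoefM big1 // => i _.
by rewrite A0 ?mul0mx //; apply: leq_ltn_trans lt_je; rewrite -ltnS.
Qed.
Lemma zero_belowD e A x : zero_below e A -> zero_below e x -> zero_below e (A + x).
Proof. by move=> A0 x0 j lt_j; rewrite mcoefD A0 // x0 // addr0. Qed.
Lemma zero_belowN e A : zero_below e A -> zero_below e (- A).
Proof. by move=> A0 j lt_j; rewrite mcoefN A0 // oppr0. Qed.

Lemma mcoef_psX m n (a j : nat) (A : 'M[pseries k]_(m, n)) :
  mcoef (psX k a *: A) j = if (a <= j)%N then mcoef A (j - a) else 0.
Proof.
by apply/matrixP => b c; rewrite !mxE pcoef_psXM; case: ifP; rewrite ?mxE.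
Qed.

Lemma mcoef_sum m n (I : finType) (F : I -> 'M[pseries k]_(m, n)) j :
  mcoef (\sum_i F i) j = \sum_i mcoef (F i) j.
Proof.
by elim/big_rec2: _ => [|a X Y _ <-]; rewrite ?mcoef0 ?mcoefD.
Qed.

Lemma series_truncation A n :
  zero_below n.+1 (A - \sum_(a < n.+1) psX k a *: cmx (mcoef A a)).
Proof.
move=> j lt_jn; rewrite mcoefB mcoef_sum; apply/eqP; rewrite subr_eq0; apply/eqP.
rewrite (bigD1 (Ordinal lt_jn)) //= mcoef_psX leqnn subnn mcoef_cmx /=.
rewrite big1 ?addr0 // => a ne_aj; rewrite mcoef_psX mcoef_cmx.
case: leqP => // le_aj; rewrite subn_eq0 leqNgt ltn_neqAle le_aj.
by rewrite -[(_ == _)]/(a == Ordinal lt_jn) ne_aj.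
Qed.

(** Expanding the middle factor in powers of t reduces conjugation of a series to conjugation of
    constant matrices. *)
Lemma mcoef_sandwich x y A n :
  mcoef (x *m A *m y) n =
  \sum_(a < n.+1) mcoef (x *m cmx (mcoef A a) *m y) (n - a).
Proof.
have S0 := @series_truncation A n; set S := \sum_a _ in S0.
rewrite -[A in LHS](subrK S) mulmxDr mulmxDl mcoefD.
rewrite (zero_below_mulr _ (zero_below_mull _ S0)) // add0r.
rewrite mulmx_sumr mulmx_suml mcoef_sum; apply: eq_bigr => a _.
by rewrite -scalemxAr -scalemxAl mcoef_psX -ltnS ltn_ord.
Qed.

(** The recursion n x_n = sum of C_i x_(n-1-i) uses all earlier coefficients, so stage n is a
    function holding coefficients 0 to n at once. *)
Fixpoint ode_prefix C n : nat -> 'M[k]_N :=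
  if n is n'.+1 then
    fun j => if j == n then
        n%:R^-1 *: \sum_(i < n) mcoef C i *m ode_prefix C n' (n' - i)
      else ode_prefix C n' j
  else fun=> 1%:M.

Lemma ode_prefix_id C n j : (j <= n)%N -> ode_prefix C n j = ode_prefix C j j.
Proof.
elim: n => [|n IHn]; first by rewrite leqn0 => /eqP ->.
by rewrite leq_eqVlt => /predU1P[-> //|lt_jn] /=; rewrite ltn_eqF // IHn.
Qed.

Hypothesis char0 : [pchar k] =i pred0.

Lemma natr_neq0 n : n.+1%:R != 0 :> k.
Proof. by rewrite (pcharf0P k).1. Qed.

Lemma ode_solution C : exists x, mcoef x 0 = 1%:M /\ mxD x = C *m x.
Proof.
pose x := \matrix_(a, b) PSeries (fun j => ode_prefix C j j a b).
have xE j : mcoef x j = ode_prefix C j j by apply/matrixP => a b; rewrite !mxE.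
exists x; split; first by rewrite xE.
apply: mcoefP => n; rewrite mcoef_mxD mcoefM xE [ode_prefix]lock /= -lock /= eqxx.
rewrite scalerA mulfV ?natr_neq0 // scale1r; apply: eq_bigr => i _.
by rewrite xE (ode_prefix_id C (leq_subr i n)).
Qed.

(* The formal curves x = 1 + O(t) whose logarithmic derivative x' x^-1 lies   *)
(* in t^e V[[t]]; they replace exp(V[[t]] t^(e+1)).                           *)
Definition integral_curve V (e : nat) x : Prop :=
  mcoef x 0 = 1%:M /\ exists C,
    [/\ mxD x = C *m x, forall n, V (mcoef C n) & zero_below e C].

Lemma integral_curve_unit V e x : integral_curve V e x -> x \in unitmx.
Proof. by case=> /unitps_mx. Qed.

Lemma integral_curve_sub V W e e' x : (forall X, V X -> W X) -> (e' <= e)%N ->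
  integral_curve V e x -> integral_curve W e' x.
Proof.
move=> sVW le_e [x0 [C [xC VC C0]]]; split=> //; exists C; split=> // [n|j lt_j].
  exact: sVW.
by apply: C0; apply: leq_trans le_e.
Qed.

(** Integration raises the order by one: the coefficient of t^(j+1) in x is that of t^j in C x,
    divided by j + 1. *)
Lemma integral_curve_cong V e x :
  integral_curve V e x -> zero_below e.+1 (x - 1%:M).
Proof.
case=> x0 [C [xC _ C0]] [_|j lt_je]; rewrite mcoefB mcoef1 ?x0 ?subrr // subr0.
apply: (scalerI (natr_neq0 j)); rewrite scaler0 -mcoef_mxD xC.
by rewrite (zero_below_mulr _ C0).
Qed.

Lemma integral_curve1 V e : V 0 -> integral_curve V e 1%:M.
Proof.
move=> V0; split; first by rewrite mcoef1.
exists 0; split=> [|n|j _]; rewrite ?mcoef0 //.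
by rewrite mxD1 mul0mx.
Qed.

Lemma mxD_inv x C : mcoef x 0 = 1%:M -> mxD x = C *m x ->
  mxD (invmx x) = - (invmx x *m C).
Proof.
move=> /unitps_mx ux xC; have := mxD1 k N.
rewrite -(mulVmx ux) mxDM xC mulmxA -mulmxDl => /(congr1 (mulmx^~ (invmx x))).
by rewrite mul0mx mulmxK // => /eqP; rewrite addr_eq0 => /eqP.
Qed.

Lemma mxD_conj x C A : mcoef x 0 = 1%:M -> mxD x = C *m x ->
  mxD (x *m A *m invmx x) =
  bracket C (x *m A *m invmx x) + x *m mxD A *m invmx x.
Proof.
move=> x0 xC; rewrite !mxDM xC (mxD_inv x0 xC) /bracket mulmxN !mulmxDl !mulmxA.
by rewrite addrAC.
Qed.

Section Conjugation.
Variables (x C : 'M[pseries k]_N).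
Hypotheses (x0 : mcoef x 0 = 1%:M) (xC : mxD x = C *m x).
Local Notation conj D := (x *m cmx D *m invmx x).

Lemma mcoef_conj0 D : mcoef (conj D) 0 = D.
Proof. by rewrite mcoefM0 mcoef_inv0 // mulmx1 mcoef_cmxr x0 mul1mx. Qed.

Lemma mcoef_conj_sub A n : mcoef (x *m A *m invmx x) n - mcoef A n =
  \sum_(a < n) mcoef (conj (mcoef A a)) (n - a).
Proof. by rewrite mcoef_sandwich big_ord_recr /= subnn mcoef_conj0 addrK. Qed.

(** The adjoint equation (x D x^-1)' = [C, x D x^-1] for constant D, read off coefficient by
    coefficient. *)
Lemma mcoef_conjS D n : n.+1%:R *: mcoef (conj D) n.+1 =
  \sum_(i < n.+1) bracket (mcoef C i) (mcoef (conj D) (n - i)).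
Proof.
rewrite -mcoef_mxD (mxD_conj _ x0 xC) mxD_cmx mulmx0 mul0mx addr0 mcoefB mcoefM.
have -> : mcoef (conj D *m C) n =
          \sum_(i < n.+1) mcoef (conj D) (n - i) *m mcoef C i.
  rewrite mcoefM (reindex_inj rev_ord_inj) /=; apply: eq_bigr => i _.
  by rewrite subSS subKn // -ltnS.
by rewrite -sumrB.
Qed.

(** By [mcoef_conjS], each coefficient of positive order is a combination of brackets of some C_i
    with D or with an earlier coefficient of positive order. *)
Lemma mcoef_conj_in V D : subspace V ->
    (forall i, V (bracket (mcoef C i) D)) ->
    (forall i Y, V Y -> V (bracket (mcoef C i) Y)) ->
  forall n, V (mcoef (conj D) n.+1).
Proof.
move=> sV VD VV; elim/ltn_ind => n IHn.
apply: (subspaceZI sV (natr_neq0 n)); rewrite mcoef_conjS.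
apply: subspace_sum => // i _.
case E: (n - i)%N => [|j]; first by rewrite mcoef_conj0.
by apply/VV/IHn; lia.
Qed.

(** In [mcoef_conjS] every term except [C_n, D] brackets some C_i with a coefficient of positive
    order, hence lies in V. Only the first-order term survives modulo V. *)
Lemma mcoef_conj_mod V W D : subspace V ->
    (forall n, W (mcoef (conj D) n.+1)) ->
    (forall i Y, W Y -> V (bracket (mcoef C i) Y)) ->
  forall n, V (mcoef (conj D) n.+1 - n.+1%:R^-1 *: bracket (mcoef C n) D).
Proof.
move=> sV WD WV n; apply: (subspaceZI sV (natr_neq0 n)).
rewrite scalerBr scalerA mulfV ?natr_neq0 // scale1r mcoef_conjS.
rewrite big_ord_recr /= subnn mcoef_conj0 addrK.
apply: subspace_sum => // i _; apply: WV.
by have /subnSK <- := ltn_ord i.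
Qed.

End Conjugation.

(** The logarithmic derivative of x y is C + x B x^-1, and conjugation by x keeps V[[t]] because V
    is closed under brackets. *)
Lemma integral_curveM V e x y : subalgebra V ->
  integral_curve V e x -> integral_curve V e y -> integral_curve V e (x *m y).
Proof.
move=> [sV VV] [x0 [C [xC VC C0]]] [y0 [B [yB VB B0]]]; split.
  by rewrite mcoefM0 x0 y0 mul1mx.
exists (C + x *m B *m invmx x); split.
- rewrite mxDM xC yB mulmxDl -!mulmxA (mulmxA (invmx x)) mulVmx ?mul1mx //.
  exact: unitps_mx.
- move=> n; rewrite mcoefD mcoef_sandwich; apply: subspaceD => //.
  apply: subspace_sum => // a _; case: (n - a)%N => [|j].
    by rewrite mcoef_conj0.
  by apply: (mcoef_conj_in x0 xC sV) => [i|i Y VY]; apply: VV.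
- by apply: zero_belowD => //; apply/zero_below_mulr/zero_below_mull.
Qed.

Lemma integral_curveV V e x : subalgebra V ->
  integral_curve V e x -> integral_curve V e (invmx x).
Proof.
move=> [sV VV] [x0 [C [xC VC C0]]]; split; first exact: mcoef_inv0.
have ux := unitps_mx x0.
(* Differentiating x^-1 D x gives x^-1 [D, C] x, with the bracket inside; the induction on n
   therefore runs over all D in V simultaneously. *)
have Vconj n : forall D, V D -> V (mcoef (invmx x *m cmx D *m x) n).
  elim/ltn_ind: n => -[_ D VD|n IHn D VD].
    by rewrite mcoefM0 x0 mulmx1 mcoef_cmxr mcoef_inv0 // mul1mx.
  apply: (subspaceZI sV (natr_neq0 n)); rewrite -mcoef_mxD.
  rewrite !mxDM (mxD_inv x0 xC) xC mxD_cmx mulmx0 addr0.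
  have -> : - (invmx x *m C) *m cmx D *m x + invmx x *m cmx D *m (C *m x) =
            invmx x *m bracket (cmx D) C *m x.
    by rewrite /bracket mulmxBr mulmxBl !mulNmx !mulmxA addrC.
  rewrite mcoef_sandwich; apply: subspace_sum => // a _; apply: IHn.
    by rewrite ltnS leq_subr.
  by rewrite mcoefB mcoef_cmxl mcoef_cmxr; apply: VV.
exists (- (invmx x *m C *m x)); split.
- by rewrite (mxD_inv x0 xC) mulNmx mulmxK.
- move=> n; rewrite mcoefN; apply: subspaceN => //.
  by rewrite mcoef_sandwich; apply: subspace_sum => // a _; apply: Vconj.
- by apply/zero_belowN/zero_below_mulr/zero_below_mull.
Qed.

End ODE.

(** * Tangent spaces and regular functions *)

Section RegularFunctions.
Variables (k : closedFieldType) (N : nat).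
Implicit Types (x y : 'M[pseries k]_N) (X Y : 'M[k]_N) (f : {mpoly k[N * N]}).
Implicit Types (S : set 'M[k]_N) (F : 'M[pseries k]_N -> pseries k).

(** The matrix of coordinate functions; evaluating it returns the argument, which turns determinants
    and adjugates into polynomial functions. *)
Definition generic_mx : 'M[{mpoly k[N * N]}]_N := \matrix_(i, j) 'X_(mxvec_index i j).

Local Notation ev x := (mmap (GRing.in_alg (pseries k)) (fun i => mxvec x 0 i)).

Lemma map_generic_mx x : map_mx (ev x) generic_mx = x.
Proof. by apply/matrixP => i j; rewrite !mxE mmapX mmap1U mxvecE. Qed.

Lemma map_generic_mxk g :
  map_mx (meval (fun i => mxvec g 0 i)) generic_mx = g :> 'M[k]_N.
Proof. by apply/matrixP => i j; rewrite !mxE mevalXU mxvecE. Qed.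

Lemma mxvec_map m n (R R' : Type) (h : R -> R') (A : 'M[R]_(m, n)) i :
  mxvec (map_mx h A) 0 i = h (mxvec A 0 i).
Proof. by case/mxvec_indexP: i => a b; rewrite !mxvecE mxE. Qed.

Lemma mxevalA_cmx f (g : 'M[k]_N) : mxevalA f (cmx g) = (mxeval f g)%:A.
Proof.
rewrite /mxeval mevalE -[RHS]/(in_alg (pseries k) _) rmorph_sum.
apply: eq_bigr => m _; rewrite rmorphM rmorph_prod; congr (_ * _).
by apply: eq_bigr => i _; rewrite rmorphXn mxvec_map.
Qed.

Lemma pcoef0_mxevalA f x : pcoef (mxevalA f x) 0 = mxeval f (mcoef x 0).
Proof.
rewrite /mxeval mevalE -[LHS]/(ps_at0 _) rmorph_sum.
apply: eq_bigr => m _; rewrite rmorphM rmorph_prod; congr (_ * _).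
  exact: mulr1.
by apply: eq_bigr => i _; rewrite rmorphXn mxvec_map.
Qed.

Lemma ps_deriv_mxevalA f x : ps_deriv (mxevalA f x) =
  \sum_(i < N * N) mxevalA f^`M(i) x * mxvec (mxD x) 0 i.
Proof.
rewrite [LHS]ps_deriv_mmap; apply: eq_bigr => i _; congr (_ * _).
by rewrite mxvec_map.
Qed.

(** First-order Taylor expansion: the differential of f at x(0) in the direction of the linear
    coefficient, in the shape used by [Lie]. *)
Lemma pcoef1_mxevalA f x : pcoef (mxevalA f x) 1 =
  \sum_(i < N * N) mxeval f^`M(i) (mcoef x 0) * mxvec (mcoef x 1) 0 i.
Proof.
rewrite -[LHS]mulr1n -[LHS]/(pcoef (ps_deriv (mxevalA f x)) 0).
rewrite ps_deriv_mxevalA pcoef_sum; apply: eq_bigr => i _.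
by rewrite pcoefM big_ord1 pcoef0_mxevalA !mxvec_map.
Qed.

(** Regular functions f / det^e on GL_N, evaluated on matrices over k[[t]], with the denominator
    cleared. *)
Definition regular F : Prop := exists f e,
  forall x, x \in unitmx -> F x * \det x ^+ e = mxevalA f x.
Definition regular_mx (M : 'M[pseries k]_N -> 'M[pseries k]_N) : Prop :=
  forall i j, regular (fun x => M x i j).

Lemma regular_const a : regular (fun=> a%:A).
Proof. by exists a%:MP, 0%N => x _; rewrite mulr1 -[RHS]/(ev x _) mmapC. Qed.

Lemma regularM F F' : regular F -> regular F' -> regular (fun x => F x * F' x).
Proof.
move=> [f [e fF]] [f' [e' fF']]; exists (f * f'), (e + e')%N => x ux.
by rewrite exprD mulrACA fF // fF' // -[RHS]/(ev x _) rmorphM.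
Qed.

Lemma regularD F F' : regular F -> regular F' -> regular (fun x => F x + F' x).
Proof.
move=> [f [e fF]] [f' [e' fF']].
exists (f * \det generic_mx ^+ e' + f' * \det generic_mx ^+ e), (e + e')%N => x ux.
rewrite -[RHS]/(ev x _) rmorphD !rmorphM !rmorphXn -det_map_mx map_generic_mx.
rewrite /= -[mmap _ _ f]/(mxevalA f x) -[mmap _ _ f']/(mxevalA f' x).
by rewrite -fF // -fF' // exprD; ring.
Qed.

Lemma regular_sum I (r : seq I) (F : I -> 'M[pseries k]_N -> pseries k) :
  (forall i, regular (F i)) -> regular (fun x => \sum_(i <- r) F i x).
Proof.
move=> rF; elim: r => [|i r IHr].
  have [f [e fE]] := regular_const 0; exists f, e => x ux.
  by rewrite big_nil -fE // scale0r.
have [f [e fE]] := regularD (rF i) IHr; exists f, e => x ux.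
by rewrite big_cons fE.
Qed.

Lemma regular_mxM M M' : regular_mx M -> regular_mx M' ->
  regular_mx (fun x => M x *m M' x).
Proof.
move=> rM rM' i j.
have [f [e fE]] := regular_sum (index_enum 'I_N)
  (fun a => regularM (rM i a) (rM' a j)).
by exists f, e => x ux; rewrite mxE fE.
Qed.

Lemma regular_mx_id : regular_mx id.
Proof.
move=> i j; exists 'X_(mxvec_index i j), 0%N => x _.
by rewrite mulr1 -[RHS]/(ev x _) mmapX mmap1U mxvecE.
Qed.

Lemma regular_mx_const X : regular_mx (fun=> cmx X).
Proof.
move=> i j; have [f [e fE]] := regular_const (X i j); exists f, e => x ux.
by rewrite mxE fE.
Qed.

Lemma regular_mx_inv : regular_mx (@invmx _ N).
Proof.
move=> i j; exists (\adj generic_mx i j), 1%N => x ux.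
rewrite /invmx ux expr1 mxE mulrAC mulVr ?mul1r; last by rewrite -unitmxE.
have := map_mx_adj (ev x) generic_mx; rewrite map_generic_mx => <-.
by rewrite mxE.
Qed.

Lemma regular_mxeval M f : regular_mx M -> regular (fun x => mxevalA f (M x)).
Proof.
move=> rM; elim/mpolyind: f => [|c m p _ _ IHp].
  have [f [e fE]] := regular_const 0; exists f, e => x ux.
  by rewrite -[mxevalA _ _]/(ev _ _) rmorph0 -fE // scale0r.
have rX : regular (fun x => ev (M x) 'X_[m]).
  have rprod (r : seq 'I_(N * N)) :
      regular (fun x => \prod_(i <- r) mxvec (M x) 0 i ^+ m i).
    have r1 : regular (fun=> 1).
      have [f [e fE]] := regular_const 1; exists f, e => x ux.
      by rewrite -fE // scale1r.
    elim: r => [|i r IHr].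
      by have [f [e fE]] := r1; exists f, e => x ux; rewrite big_nil fE.
    have rXi d : regular (fun x => mxvec (M x) 0 i ^+ d).
      elim: d => [//|d IHd].
      case/mxvec_indexP: i IHd => a b IHd.
      have [f [e fE]] := regularM (rM a b) IHd; exists f, e => x ux.
      by rewrite -fE // exprS mxvecE.
    have [f [e fE]] := regularM (rXi (m i)) IHr; exists f, e => x ux.
    by rewrite big_cons fE.
  have [f [e fE]] := rprod (index_enum _); exists f, e => x ux.
  by rewrite mmapX /mmap1 fE.
have [f [e fE]] := regularD (regularM (regular_const c) rX) IHp.
by exists f, e => x ux; rewrite -fE // -[mxevalA _ _]/(ev _ _) mmapD mmapZ.
Qed.

(** A first-order curve through 1 with velocity X, in general not inside the group; only its
    coefficients 0 and 1 are used. *)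
Definition line X : 'M[pseries k]_N := 1%:M + psX k 1 *: cmx X.

Lemma mcoef0_line X : mcoef (line X) 0 = 1%:M.
Proof. by rewrite mcoefD mcoef1 mcoef_psX addr0. Qed.
Lemma mcoef1_line X : mcoef (line X) 1 = X.
Proof. by rewrite mcoefD mcoef1 mcoef_psX add0r mcoef_cmx. Qed.
Lemma mcoef0_line_inv X : mcoef (invmx (line X)) 0 = 1%:M.
Proof. by rewrite mcoef_inv0 ?mcoef0_line. Qed.
Lemma mcoef1_line_inv X : mcoef (invmx (line X)) 1 = - X.
Proof.
have := mulmxV (unitps_mx (mcoef0_line X)) => /(congr1 (fun y => mcoef y 1)).
rewrite mcoefM big_ord_recl big_ord1 /= mcoef1 mcoef0_line mcoef1_line.
by rewrite mcoef0_line_inv mul1mx mulmx1 => /eqP; rewrite addr_eq0 => /eqP.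
Qed.

Lemma mcoefM1 x y : mcoef (x *m y) 1 =
  mcoef x 0 *m mcoef y 1 + mcoef x 1 *m mcoef y 0.
Proof. by rewrite mcoefM big_ord_recl big_ord1. Qed.

Lemma unit_cmx (g : 'M[k]_N) : g \in unitmx -> cmx g \in unitmx.
Proof. by move=> ug; rewrite map_unitmx. Qed.

Lemma invmx_cmx (g : 'M[k]_N) : invmx (cmx g) = cmx (invmx g).
Proof. by rewrite /cmx map_invmx. Qed.

(* Evaluating at 1 + tX tests tangency without any curve in the group.       *)
Lemma regular_Lie S F X : S 1%:M -> (forall g, S g -> g \in unitmx) ->
    regular F -> (forall g, S g -> F (cmx g) = 0) -> Lie S X ->
  pcoef (F (line X)) 1 = 0.
Proof.
move=> S1 Su [f [e fF]] F0 SX.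
have vf : vanishing S f.
  move=> g Sg; have := fF _ (unit_cmx (Su g Sg)); rewrite F0 // mul0r mxevalA_cmx.
  move=> /(congr1 (fun u => pcoef u 0)) /eqP.
  by rewrite pcoefZ pcoef1 mulr1 eq_sym => /eqP.
have := fF _ (unitps_mx (mcoef0_line X)); set d := _ ^+ _ => Fd.
have d0 : pcoef d 0 = 1.
  rewrite -[LHS]/(ps_at0 d) rmorphXn -det_map_mx -[map_mx _ _]/(mcoef _ 0).
  by rewrite mcoef0_line det1 expr1n.
have F0' : pcoef (F (line X)) 0 = 0.
  have := congr1 (fun u => pcoef u 0) Fd; rewrite pcoefM big_ord1 d0 mulr1 => ->.
  by rewrite pcoef0_mxevalA mcoef0_line vf.
have := congr1 (fun u => pcoef u 1) Fd.
rewrite pcoef1_mxevalA mcoef0_line mcoef1_line SX // pcoefM big_ord_recl big_ord1.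
by rewrite /= F0' mul0r add0r subnn d0 mulr1.
Qed.

(** Functions vanishing on S' pull back along M to regular functions vanishing on S, so the
    differential of M at 1 preserves tangency. *)
Lemma Lie_regular_map S S' M X : S 1%:M -> (forall g, S g -> g \in unitmx) ->
    regular_mx M -> mcoef (M (line X)) 0 = 1%:M ->
    (forall g, S g -> exists2 g', S' g' & M (cmx g) = cmx g') ->
  Lie S X -> Lie S' (mcoef (M (line X)) 1).
Proof.
move=> S1 Su rM M0 SM SX f vf; rewrite -[in LHS]M0 -pcoef1_mxevalA.
apply: (regular_Lie S1 Su (regular_mxeval f rM) _ SX) => g /SM[g' S'g' ->].
by rewrite mxevalA_cmx vf // scale0r.
Qed.

Lemma Lie_subspace S : subspace (Lie S).
Proof.
split=> [f _|a X Y SX SY f vf]; first by rewrite big1 // => i _; rewrite linear0 mxE mulr0.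
under eq_bigr do rewrite linearD linearZ !mxE mulrDr mulrCA.
by rewrite big_split -mulr_sumr /= SX // SY // mulr0 addr0.
Qed.

Lemma Lie_mono S S' : (forall g, S g -> S' g) -> forall X, Lie S X -> Lie S' X.
Proof. by move=> sSS' X SX f vf; apply: SX => g Sg; apply/vf/sSS'. Qed.

(** The coordinates minus their values at 1 vanish on the trivial group, and their differentials are
    the entries of X. *)
Lemma Lie_one X : Lie [set 1%:M] X -> X = 0.
Proof.
move=> LX; apply/matrixP => a b; rewrite [RHS]mxE.
set i := mxvec_index a b.
have := LX ('X_i - (mxvec 1%:M 0 i)%:MP); rewrite (bigD1 i) //= big1.
  rewrite addr0 mderivB mderivC subr0 mderivX mnm1E eqxx scale1r.
  rewrite (_ : (U_(i) - U_(i))%MM = 0%MM); last by apply/mnmP => j; rewrite !mnmE subnn.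
  rewrite /mxeval mpolyX0 meval1 mul1r /i !mxvecE; apply.
  by move=> g -> /=; rewrite /mxeval mevalB mevalC mevalXU mxvecE subrr.
move=> j ne_ji; rewrite mderivB mderivC subr0 mderivX mnm1E eq_sym (negbTE ne_ji).
by rewrite scale0r /mxeval meval0 mul0r.
Qed.

(** For f vanishing on S'', the differential of f at 1 applied to X - h X h^-1 is a regular function
    of h vanishing on S. Its derivative at h = 1 along Y is that differential applied to -[Y, X]. *)
Lemma Lie_bracket_of_conj S S'' X Y :
    S 1%:M -> (forall g, S g -> g \in unitmx) ->
    (forall h, S h -> Lie S'' (X - h *m X *m invmx h)) ->
  Lie S Y -> Lie S'' (bracket Y X).
Proof.
move=> S1 Su SX SY f vf.
pose c i := mxeval f^`M(i) 1%:M.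
pose M x := x *m cmx X *m invmx x.
have rM : regular_mx M.
  by apply: regular_mxM regular_mx_inv; apply: regular_mxM regular_mx_id (regular_mx_const X).
pose F x := \sum_(i < N * N) (c i)%:A * (mxvec (cmx X) 0 i + (-1)%:A * mxvec (M x) 0 i).
have rF : regular F.
  apply: regular_sum => i; case/mxvec_indexP: i => a b.
  have [g [e gE]] := regularM (regular_const (c (mxvec_index a b)))
    (regularD (regular_mx_const X a b) (regularM (regular_const (-1)) (rM a b))).
  by exists g, e => x ux; rewrite -gE // !mxvecE.
have F0 h : S h -> F (cmx h) = 0.
  move=> Sh; rewrite /F /M invmx_cmx -!cmxM.
  apply: (@etrans _ _ (GRing.in_alg (pseries k) 0)); last exact: rmorph0.
  rewrite -(SX h Sh f vf) rmorph_sum.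
  apply: eq_bigr => i _.
  by rewrite rmorphM linearB !mxE rmorphB !mxvec_map scaleN1r mulN1r.
have := regular_Lie S1 Su rF F0 SY.
rewrite /F pcoef_sum => E; apply/eqP; rewrite -oppr_eq0 -sumrN; apply/eqP.
rewrite -[RHS]E; apply: eq_bigr => i _.
rewrite -scalerAl mul1r pcoefZ pcoefD -scalerAl mul1r pcoefZ mulN1r -/(c i) -mulrN.
rewrite -!(mxvec_map (fun u => pcoef u 1)) -!/(mcoef _ 1).
rewrite mcoef_cmx /= linear0 mxE add0r /M mcoefM1 !mcoef_cmxr mcoef0_line.
rewrite mul1mx mcoef1_line_inv mcoef1_line mcoef0_line_inv mulmx1.
by rewrite mulmxN addrC.
Qed.

(** The commutator is differentiated first in g at 1 along X, giving X - h X h^-1 in Lie S'', and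
    then in h by [Lie_bracket_of_conj]. *)
Lemma Lie_commutator S S' S'' X Y :
    S 1%:M -> (forall g, S g -> g \in unitmx) ->
    S' 1%:M -> (forall g, S' g -> g \in unitmx) ->
    (forall g h, S g -> S' h -> S'' (g *m h *m invmx g *m invmx h)) ->
  Lie S X -> Lie S' Y -> Lie S'' (bracket Y X).
Proof.
move=> S1 Su S'1 S'u comm SX; apply: Lie_bracket_of_conj => // h S'h.
pose M x := x *m cmx h *m invmx x *m cmx (invmx h).
have rM : regular_mx M.
  apply: regular_mxM (regular_mx_const _); apply: regular_mxM regular_mx_inv.
  exact: regular_mxM regular_mx_id (regular_mx_const h).
have uh := S'u h S'h.
have M0 : mcoef (M (line X)) 0 = 1%:M.
  rewrite mcoefM0 mcoefM0 mcoefM0 mcoef0_line mcoef0_line_inv !mcoef_cmx /=.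
  by rewrite mul1mx mulmx1 mulmxV.
have -> : X - h *m X *m invmx h = mcoef (M (line X)) 1.
  rewrite mcoef_cmxr mcoefM1 !mcoef_cmxr mcoef0_line mul1mx.
  rewrite mcoef1_line_inv mcoef0_line_inv mcoef1_line mulmx1.
  by rewrite mulmxDl mulmxK // mulmxN mulNmx addrC.
apply: (Lie_regular_map S1 Su rM M0 _ SX) => g Sg.
exists (g *m h *m invmx g *m invmx h); first exact: comm.
by rewrite /M invmx_cmx !cmxM.
Qed.

Lemma Lie_conj S g Y : S 1%:M -> (forall h, S h -> h \in unitmx) ->
    g \in unitmx -> (forall h, S h -> S (g *m h *m invmx g)) ->
  Lie S Y -> Lie S (g *m Y *m invmx g).
Proof.
move=> S1 Su ug Sg SY.
pose M x := cmx g *m x *m cmx (invmx g).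
have rM : regular_mx M.
  apply: regular_mxM (regular_mx_const _).
  exact: regular_mxM (regular_mx_const g) regular_mx_id.
have -> : g *m Y *m invmx g = mcoef (M (line Y)) 1.
  by rewrite mcoef_cmxr mcoef_cmxl mcoef1_line.
apply: (Lie_regular_map S1 Su rM _ _ SY).
  by rewrite mcoef_cmxr mcoef_cmxl mcoef0_line mulmx1 mulmxV.
move=> h Sh; exists (g *m h *m invmx g); first exact: Sg.
by rewrite /M !cmxM.
Qed.

Lemma Lie_normal S S' X Y :
    S 1%:M -> (forall g, S g -> g \in unitmx) ->
    S' 1%:M -> (forall g, S' g -> g \in unitmx) ->
    (forall g h, S g -> S' h -> S' (g *m h *m invmx g)) ->
  Lie S X -> Lie S' Y -> Lie S' (bracket X Y).
Proof.
move=> S1 Su S'1 S'u nS SX SY; apply: Lie_bracket_of_conj SX => // g Sg.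
apply: (subspaceB (Lie_subspace S') SY).
by apply: Lie_conj => //; [apply: Su | move=> h; apply: nS].
Qed.

Section IntegralCurves.
Variable S : set 'M[k]_N.
Hypotheses (char0 : [pchar k] =i pred0) (S1 : S 1%:M).
Hypotheses (SM : forall g h, S g -> S h -> S (g *m h)).
Hypothesis Su : forall g, S g -> g \in unitmx.

(** The right-invariant vector field g |-> X g applied to f, as a polynomial. *)
Definition right_derivation X f : {mpoly k[N * N]} :=
  \sum_(i < N * N) f^`M(i) * mxvec (map_mx (@mpolyC _ k) X *m generic_mx) 0 i.

Lemma mxevalA_right_derivation X f x : mxevalA (right_derivation X f) x =
  \sum_(i < N * N) mxevalA f^`M(i) x * mxvec (cmx X *m x) 0 i.
Proof.
rewrite -[LHS]/(ev x _) rmorph_sum; apply: eq_bigr => i _.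
rewrite rmorphM -mxvec_map map_mxM map_generic_mx -map_mx_comp.
congr (_ * mxvec (_ *m _) 0 i); apply/matrixP => a b; rewrite !mxE /=.
by rewrite mmapC.
Qed.

Lemma mxeval_right_derivation X f g : mxeval (right_derivation X f) g =
  \sum_(i < N * N) mxeval f^`M(i) g * mxvec (X *m g) 0 i.
Proof.
rewrite /mxeval rmorph_sum; apply: eq_bigr => i _.
rewrite rmorphM -mxvec_map map_mxM map_generic_mxk -map_mx_comp.
congr (_ * mxvec (_ *m _) 0 i); apply/matrixP => a b; rewrite !mxE /=.
by rewrite mevalC.
Qed.

(** For g in S the function h |-> f(h g) vanishes on S; its derivative at h = 1 along X is the value
    of the derivation at g. *)
Lemma vanishing_right_derivation X f :
  Lie S X -> vanishing S f -> vanishing S (right_derivation X f).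
Proof.
move=> SX vf g Sg; rewrite mxeval_right_derivation.
pose M x := x *m cmx g.
have rM : regular_mx M := regular_mxM regular_mx_id (regular_mx_const g).
have := regular_Lie S1 Su (regular_mxeval f rM) _ SX.
rewrite pcoef1_mxevalA /M !mcoef_cmxr mcoef0_line mcoef1_line mul1mx; apply.
by move=> h Sh; rewrite -cmxM mxevalA_cmx vf ?scale0r //; apply: SM.
Qed.

(* The Taylor coefficients of f(x(t)) are computed from right-invariant       *)
(* derivations of f, which preserve the ideal of S.                           *)
Lemma integral_curve_points e x : integral_curve (Lie S) e x -> points S x.
Proof.
move=> [x0 [C [xC SC _]]]; split; first exact: unitps_mx.
suff coef0 n f : vanishing S f -> pcoef (mxevalA f x) n = 0.
  by move=> f vf; apply: pseriesP => n; rewrite coef0.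
elim/ltn_ind: n f => -[_|n IHn] f vf; first by rewrite pcoef0_mxevalA x0 vf.
apply: (mulfI (natr_neq0 char0 n)); rewrite mulr0 mulr_natl.
rewrite -[LHS]/(pcoef (ps_deriv (mxevalA f x)) n) ps_deriv_mxevalA xC.
have T0 := @series_truncation _ _ C n; set T := \sum_a _ in T0.
rewrite -[C](subrK T) mulmxDl.
under eq_bigr do rewrite linearD mxE mulrDr.
rewrite big_split pcoefD pcoef_sum big1 ?add0r => [|i _]; last first.
  rewrite pcoefM big1 // => j _.
  rewrite -(mxvec_map (fun u => pcoef u (n - j))) -/(mcoef _ _).
  by rewrite (zero_below_mulr _ T0) ?linear0 ?mxE ?mulr0 // ltnS leq_subr.
have -> : \sum_(i < N * N) mxevalA f^`M(i) x * mxvec (T *m x) 0 i =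
    \sum_(a < n.+1) psX k a * mxevalA (right_derivation (mcoef C a) f) x.
  under [RHS]eq_bigr do rewrite mxevalA_right_derivation mulr_sumr.
  rewrite exchange_big; apply: eq_bigr => i _.
  rewrite /T mulmx_suml linear_sum summxE mulr_sumr; apply: eq_bigr => a _.
  by rewrite -scalemxAl linearZ mxE mulrCA.
rewrite pcoef_sum big1 // => a _; rewrite pcoef_psXM -ltnS ltn_ord.
by rewrite IHn ?ltnS ?leq_subr //; apply: vanishing_right_derivation.
Qed.

End IntegralCurves.
End RegularFunctions.

(** * Lie algebras of T, U and the upper central series *)

Section LieAlgebras.
Variables (k : closedFieldType) (N : nat) (G T U : set 'M[k]_N).
Hypotheses (hG : linear_alggroup G) (hT : torus T) (hU : unipotent U).
Hypothesis hGTU : semidirect G T U.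
Implicit Types (g h s : 'M[k]_N) (X Y D : 'M[k]_N).

Let G1 : G 1%:M. Proof. by case: hG => -[]. Qed.
Let Gu g : G g -> g \in unitmx. Proof. by case: hG => -[_ _ _ Gu] _; apply: Gu. Qed.
Let T1 : T 1%:M. Proof. by case: hT => -[[]]. Qed.
Let Tu g : T g -> g \in unitmx.
Proof. by case: hT => -[[_ _ _ Tu] _] _; apply: Tu. Qed.
Let U1 : U 1%:M. Proof. by case: hU => -[[]]. Qed.
Let Uu g : U g -> g \in unitmx.
Proof. by case: hU => -[[_ _ _ Uu] _] _; apply: Uu. Qed.
Let TG g : T g -> G g. Proof. by case: hGTU => TG _ _ _ _; apply: TG. Qed.
Let UG g : U g -> G g. Proof. by case: hGTU => _ UG _ _ _; apply: UG. Qed.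

Lemma alggroup_conj S g h : @linear_alggroup k N S -> S g -> S h ->
  S (g *m h *m invmx g).
Proof. by move=> [[_ SM SV _] _] Sg Sh; apply/SM/SV => //; apply: SM. Qed.

Lemma Lie_alggroup_subalgebra S : @linear_alggroup k N S -> subalgebra (Lie S).
Proof.
move=> algS; have [[S1 SM SV Su] _] := algS; split; first exact: Lie_subspace.
by move=> X Y; apply: Lie_normal => // g h; apply: alggroup_conj.
Qed.

(** Transported from invertible diagonal matrices along the isomorphism. *)
Lemma torus_commute g h : T g -> T h -> g *m h = h *m g.
Proof.
case: hT => _ [r [phi [psi [[_ phiM _] [psiT _ _] _ phiK]]]] Tg Th.
rewrite -(phiK _ Tg) -(phiK _ Th) -!phiM; try exact: psiT.
congr phi; have [_ /is_diag_mxP dg] := psiT _ Tg; have [_ /is_diag_mxP dh] := psiT _ Th.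
apply/matrixP => i j; rewrite !mxE; apply: eq_bigr => a _.
case: (eqVneq i a) => [->|ia]; last by rewrite (dg i a) // (dh i a) // !mul0r.
case: (eqVneq a j) => [->|aj]; first exact: mulrC.
by rewrite (dg a j) // (dh a j) // !mulr0.
Qed.

Lemma Lie_torus_bracket X Y : Lie T X -> Lie T Y -> bracket X Y = 0.
Proof.
move=> TX TY; apply: Lie_one; move: TY TX; apply: Lie_commutator => // g h Tg Th.
by rewrite /= (torus_commute Tg Th) mulmxK ?mulmxV // ?Tu.
Qed.

Lemma upper_central_one i : upper_central U i 1%:M.
Proof.
elim: i => [//|i IHi]; split=> // h Uh.
by rewrite mul1mx invmx1 mulmx1 mulmxV // Uu.
Qed.

Lemma upper_central_sub i g : upper_central U i g -> U g.
Proof. by case: i => [->//|i []]. Qed.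

(** The commutator of s g s^-1 with h is the s-conjugate of the commutator of g with s^-1 h s, which
    again ranges over U. *)
Lemma upper_central_conj i s g : G s -> upper_central U i g ->
  upper_central U i (s *m g *m invmx s).
Proof.
move=> Gs; have us := Gu Gs; have [_ _ nU _ _] := hGTU.
elim: i g => [g -> /=|i IHi g [Ug gZ]]; first by rewrite mulmx1 mulmxV.
have ug := Uu Ug; split=> [|h Uh]; first exact: nU.
have uh := Uu Uh.
have Gs' : G (invmx s) by case: hG => -[_ _ GV _] _; apply: GV.
have us' : invmx s \in unitmx by rewrite unitmx_inv.
have := IHi _ (gZ _ (nU _ _ Gs' Uh)); rewrite invmxK.
have -> : invmx (s *m g *m invmx s) = s *m invmx g *m invmx s.
  by rewrite !invmx_mul ?invmxK ?mulmxA ?unitmx_mul ?us.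
have -> : invmx (invmx s *m h *m s) = invmx s *m invmx h *m s.
  by rewrite !invmx_mul ?invmxK ?mulmxA ?unitmx_mul ?us'.
by rewrite !mulmxA mulmxK.
Qed.

Lemma Lie_upper_central0 X : Lie (upper_central U 0) X -> X = 0.
Proof. exact: Lie_one. Qed.

Lemma Lie_upper_central_sub i X : Lie (upper_central U i) X -> Lie U X.
Proof. by apply: Lie_mono => g; apply: upper_central_sub. Qed.

Lemma Lie_upper_central_bracket i X Y : Lie (upper_central U i.+1) X ->
  Lie U Y -> Lie (upper_central U i) (bracket X Y).
Proof.
move=> ZX UY; rewrite bracketC; apply: (subspaceN (Lie_subspace _)).
move: ZX UY; apply: Lie_commutator => //; first exact: upper_central_one.
  by move=> g /upper_central_sub /Uu.
by move=> g h [_ gZ] /gZ.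
Qed.

Lemma Lie_normalizes_upper_central i X Y : Lie G X ->
  Lie (upper_central U i) Y -> Lie (upper_central U i) (bracket X Y).
Proof.
apply: Lie_normal => //; first exact: upper_central_one.
  by move=> g /upper_central_sub /Uu.
by move=> g h; apply: upper_central_conj.
Qed.

Lemma Lie_normalizes_U X Y : Lie G X -> Lie U Y -> Lie U (bracket X Y).
Proof. by apply: Lie_normal => //; case: hGTU. Qed.

Lemma Lie_T_G X : Lie T X -> Lie G X. Proof. exact: Lie_mono. Qed.
Lemma Lie_U_G X : Lie U X -> Lie G X. Proof. exact: Lie_mono. Qed.

End LieAlgebras.

Lemma points_laurent (k : closedFieldType) N (S : set 'M[k]_N) (x : 'M[pseries k]_N) :
  points S x -> points S (mxF x).
Proof.
move=> [ux vx]; split.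
  rewrite unitmxE det_map_mx; apply: (rmorph_unit (@laurent_of_pseries k)).
  by rewrite -unitmxE.
move=> f vf; rewrite -(rmorph0 (@laurent_of_pseries k)) -(vx f vf).
rewrite /mxevalA /mmap rmorph_sum; apply: eq_bigr => m _.
rewrite rmorphM rmorph_prod; congr (_ * _).
  apply: laurentP => j.
  rewrite -[LHS]/(_ * Defs.lshift 0 1 j) -[RHS]/(Defs.lshift 0 _ j) !lshiftE.
  by case: ifP; rewrite ?mulr0.
by apply: eq_bigr => i _; rewrite rmorphXn mxvec_map.
Qed.

Section VectorSpaces.
Variables (k : fieldType) (N : nat).

(** Take W inside V of maximal dimension; a vector of V outside W would give the larger space W +
    <[X]>. *)
Lemma subspace_vspace (V : set 'M[k]_N) : subspace V ->
  exists W : {vspace 'M[k]_N}, forall X, X \in W <-> V X.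
Proof.
move=> sV; pose P d := `[< exists2 W : {vspace 'M[k]_N}, \dim W = d &
  forall X, X \in W -> V X >].
have exP : exists d, P d.
  exists 0%N; apply/asboolP; exists 0%VS; first exact: dimv0.
  by move=> X; rewrite memv0 => /eqP ->; case: sV.
have ubP d : P d -> (d <= \dim {:'M[k]_N})%N.
  by move=> /asboolP[W <- _]; apply: dimvS; apply: subvf.
case: (ex_maxnP exP ubP) => d /asboolP[W dW WV] maxW.
exists W => X; split=> [|VX]; first exact: WV.
apply/negPn/negP => nWX.
have /maxW : P (\dim (W + <[X]>)).
  apply/asboolP; exists (W + <[X]>)%VS => // Y /memv_addP[Z WZ [_ /vlineP[a ->] ->]].
  by apply: (subspaceD sV); [apply: WV | apply: subspaceZ].
rewrite -dW leqNgt; case/negP; rewrite ltn_neqAle dimvS ?addvSl // andbT.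
apply/eqP => eq_dim; case/negP: nWX.
have /eqP -> : W == (W + <[X]>)%VS by rewrite eqEdim addvSl eq_dim leqnn.
exact: (subvP (addvSr W <[X]>%VS)) _ (memv_line X).
Qed.

(** When c is not an eigenvalue, c - ad D is an injective endomorphism of a finite-dimensional
    space, hence onto. *)
Lemma bracket_solve (V : set 'M[k]_N) (D : 'M[k]_N) (c : k) : subspace V ->
    (forall Y, V Y -> V (bracket D Y)) ->
    (forall Y, V Y -> bracket D Y = c *: Y -> Y = 0) ->
  forall E, V E -> exists2 Y, V Y & c *: Y - bracket D Y = E.
Proof.
move=> sV DV inj E VE; have [W WV] := subspace_vspace sV.
pose f Y := c *: Y - bracket D Y.
have f_lin : linear f.
  move=> a X Y; rewrite /f scalerDr scalerA mulrC -scalerA bracketDr bracketZr.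
  by rewrite opprD addrACA -scalerBr.
have [g gE] : exists g : 'End('M[k]_N), forall Y, g Y = f Y.
  pose fl : {linear 'M[k]_N -> 'M[k]_N} := HB.pack f (GRing.isLinear.Build _ _ _ _ f f_lin).
  by exists (linfun fl) => Y; rewrite lfunE.
have sgW : (g @: W <= W)%VS.
  apply/subvP => _ /memv_imgP[Y /WV VY ->]; rewrite gE; apply/WV.
  by apply: (subspaceB sV); [apply: subspaceZ | apply: DV].
have /eqP gW : (g @: W)%VS == W.
  rewrite eqEdim sgW limg_dim_eq ?leqnn //; apply/eqP; rewrite -subv0.
  apply/subvP => Y; rewrite memv_cap => /andP[/WV VY]; rewrite memv_ker gE.
  by rewrite memv0 subr_eq0 => /eqP/esym/(inj _ VY)/eqP.
have : E \in (g @: W)%VS by rewrite gW; apply/WV.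
by case/memv_imgP => Y /WV VY ->; exists Y => //; rewrite gE.
Qed.

End VectorSpaces.

(** * Laurent matrices and the gauge action *)

Section LaurentMatrices.
Variables (k : closedFieldType) (N : nat).
Implicit Types (A B : 'M[laurent k]_N) (x y C : 'M[pseries k]_N) (X D : 'M[k]_N).
Implicit Types (V W : set 'M[k]_N).

Lemma coefmxP A B : coefmx A =1 coefmx B -> A = B.
Proof.
move=> eAB; apply/matrixP => a b; apply: laurentP => j.
by have /matrixP/(_ a b) := eAB j; rewrite !mxE.
Qed.
Lemma coefmxD A B j : coefmx (A + B) j = coefmx A j + coefmx B j.
Proof. by apply/matrixP => a b; rewrite !mxE. Qed.
Lemma coefmxN A j : coefmx (- A) j = - coefmx A j.
Proof. by apply/matrixP => a b; rewrite !mxE. Qed.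
Lemma coefmxB A B j : coefmx (A - B) j = coefmx A j - coefmx B j.
Proof. by rewrite coefmxD coefmxN. Qed.

Lemma coefmx_mxF x (j : int) :
  coefmx (mxF x) j = if 0 <= j then mcoef x (absz j) else 0.
Proof.
apply/matrixP => a b; rewrite !mxE -[LHS]/(Defs.lshift 0 _ j) lshiftE addr0.
by case: ifP; rewrite mxE.
Qed.

Lemma coefmx_mxF_nat x (n : nat) : coefmx (mxF x) n%:Z = mcoef x n.
Proof. by rewrite coefmx_mxF. Qed.

Lemma lcoef_lmonM (d : int) (f : laurent k) (j : int) : (lmon k d * f) j = f (j - d).
Proof.
have fM := @lbndP _ f; set M := lbnd f in fM; pose n := absz d.
have dn : 0 <= d + n%:Z by rewrite /n; lia.
rewrite -[LHS]/(laurent_mul _ _ j) (lmonK k dn).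
rewrite (laurent_mulE (@lshift_bounded _ _ _) fM) lshiftE lshiftK pcoef_psXM.
case: ifP => [le0|/negbT lt0]; last by rewrite fM //; lia.
case: leqP => h; last by rewrite fM //; lia.
by rewrite /=; congr (f _); lia.
Qed.

Lemma coefmx_lmon d A j : coefmx (lmon k d *: A) j = coefmx A (j - d).
Proof. by apply/matrixP => a b; rewrite !mxE lcoef_lmonM. Qed.

(** M bounds the poles of all entries, so statements on Laurent matrices reduce to matrices over
    k[[t]]. *)
Lemma laurent_mx_split A : exists (M : nat) (y : 'M[pseries k]_N),
  A = lmon k (- M%:Z) *: mxF y.
Proof.
pose M := \max_(i < N) \max_(j < N) lbnd (A i j).
exists M, (map_mx (psh M) A); apply/matrixP => a b; apply: laurentP => j.
have AM : lbounded M (A a b).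
  apply: lbounded_leq (@lbndP _ (A a b)).
  rewrite /M (bigD1 a) //= leq_max; apply/orP; left.
  by rewrite (bigD1 b) //= leq_max leqnn.
rewrite !mxE lcoef_lmonM -[RHS]/(Defs.lshift 0 _ _) lshiftE.
case: ifP => h; last by rewrite AM //; lia.
by rewrite /=; congr (A a b _); lia.
Qed.

Lemma tmxE d X : tmx d X = lmon k d *: mxF (cmx X).
Proof.
rewrite /tmx; congr (_ *: _); apply/matrixP => a b; rewrite !mxE.
apply: laurentP => i.
rewrite -[LHS]/(_ * Defs.lshift 0 1 i) -[RHS]/(Defs.lshift 0 _ i) !lshiftE.
by case: ifP; rewrite ?mulr0.
Qed.

Lemma coefmx_tmx d X j : coefmx (tmx d X) j = if j == d then X else 0.
Proof.
rewrite tmxE coefmx_lmon coefmx_mxF mcoef_cmx.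
case: ifP => h; last by rewrite ifF //; lia.
by rewrite absz_eq0 subr_eq0.
Qed.

Lemma mxFM x y : mxF (x *m y) = mxF x *m mxF y.
Proof. exact: map_mxM. Qed.

Lemma laurent_deriv_mxF x : map_mx (@laurent_deriv k) (mxF x) = mxF (mxD x).
Proof.
apply/matrixP => a b; rewrite !mxE; apply: laurentP => j.
rewrite -[LHS]/(Defs.lshift 0 _ (j + 1) *~ (j + 1)) -[RHS]/(Defs.lshift 0 _ j).
rewrite !lshiftE !addr0; case: (ltP j 0) => [lt0|le0].
  case: (eqVneq j (-1)) => [-> //|ne].
  by rewrite ifF ?mul0rz //; lia.
rewrite ifT; last lia.
have -> : j + 1 = (absz j).+1%:Z by lia.
by rewrite /= -pmulrn.
Qed.

Lemma invmx_mxF x : x \in unitmx -> invmx (mxF x) = mxF (invmx x).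
Proof.
move=> ux; have uFx : mxF x \in unitmx.
  rewrite unitmxE det_map_mx; apply: (rmorph_unit (@laurent_of_pseries k)).
  by rewrite -unitmxE.
by rewrite -[RHS](mulKmx uFx) -mxFM mulmxV // /mxF map_mx1 mulmx1.
Qed.

(** The adjoint part Ad(x) A of the gauge action, for x over k[[t]]. *)
Definition conjF x A := mxF x *m A *m mxF (invmx x).

Lemma conjFD x A B : conjF x (A + B) = conjF x A + conjF x B.
Proof. by rewrite /conjF mulmxDr mulmxDl. Qed.

Lemma gaugeE x A : x \in unitmx ->
  gauge (mxF x) A = conjF x A + mxF (mxD x *m invmx x).
Proof. by move=> ux; rewrite /gauge laurent_deriv_mxF invmx_mxF // mxFM. Qed.

Lemma mxFD x y : mxF (x + y) = mxF x + mxF y.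
Proof. exact: map_mxD. Qed.
Lemma conjF_mxF x y : conjF x (mxF y) = mxF (x *m y *m invmx x).
Proof. by rewrite /conjF -!mxFM. Qed.
Lemma conjFM x y A : invmx (x *m y) = invmx y *m invmx x ->
  conjF (x *m y) A = conjF x (conjF y A).
Proof.
have assoc (a b c d e : 'M[laurent k]_N) :
    a *m b *m c *m (d *m e) = a *m (b *m c *m d) *m e by rewrite !mulmxA.
rewrite /conjF => ->; rewrite (mxFM x y) (mxFM (invmx y) (invmx x)).
exact: assoc.
Qed.

(** This rests on the cocycle rule (x y)' (x y)^-1 = x' x^-1 + x (y' y^-1) x^-1. *)
Lemma gaugeM x y A : x \in unitmx -> y \in unitmx ->
  gauge (mxF (x *m y)) A = gauge (mxF x) (gauge (mxF y) A).
Proof.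
move=> ux uy; have uxy : x *m y \in unitmx by rewrite unitmx_mul ux uy.
have ixy := invmx_mul ux uy.
rewrite (gaugeE _ uxy) (gaugeE _ ux) (gaugeE _ uy) (conjFD x (conjF y A)).
rewrite (conjF_mxF x (mxD y *m invmx y)) (conjFM A ixy) -addrA.
rewrite -(mxFD (x *m (mxD y *m invmx y) *m invmx x) (mxD x *m invmx x)).
congr (_ + mxF _).
rewrite ixy mxDM mulmxDl addrC; congr (_ + _); first by rewrite !mulmxA.
by rewrite mulmxA mulmxK.
Qed.

Lemma gauge1 A : gauge (mxF 1%:M) A = A.
Proof.
rewrite gaugeE ?unitmx1 // /conjF invmx1 mxD1 mul0mx /mxF map_mx1 mul1mx mulmx1.
by rewrite raddf0 addr0.
Qed.

Lemma conjF_lmon x d y :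
  conjF x (lmon k d *: mxF y) = lmon k d *: mxF (x *m y *m invmx x).
Proof. by rewrite -conjF_mxF /conjF -scalemxAr -scalemxAl. Qed.

(** Coefficient j of x A x^-1 is A_j plus, for each d > 0, the t^d coefficient of the conjugate of
    the constant matrix A_(j-d); these contributions can be tested one at a time. *)
Lemma coefmx_conjF_mod V x A (j : int) : subspace V -> mcoef x 0 = 1%:M ->
    (forall n : nat,
       V (mcoef (x *m cmx (coefmx A (j - n.+1%:Z)) *m invmx x) n.+1)) ->
  V (coefmx (conjF x A) j - coefmx A j).
Proof.
move=> sV x0; have [M [y yA]] := laurent_mx_split A => VA.
have An n : coefmx A (n%:Z - M%:Z) = mcoef y n.
  by rewrite yA coefmx_lmon opprK subrK coefmx_mxF_nat.
have conjA : coefmx (conjF x A) j = coefmx (mxF (x *m y *m invmx x)) (j + M%:Z).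
  by rewrite [in LHS]yA conjF_lmon coefmx_lmon opprK.
have Aj : coefmx A j = coefmx (mxF y) (j + M%:Z).
  by rewrite [in LHS]yA coefmx_lmon opprK.
case: (ltP (j + M%:Z) 0) => [lt0|le0].
  rewrite conjA Aj !coefmx_mxF lt_geF // subrr; by case: sV.
have [n nE] : exists n : nat, n%:Z = j + M%:Z by exists (absz (j + M%:Z)); lia.
have -> : coefmx (conjF x A) j - coefmx A j =
    \sum_(a < n) mcoef (x *m cmx (mcoef y a) *m invmx x) (n - a).
  rewrite conjA Aj -nE (coefmx_mxF_nat (x *m y *m invmx x) n) (coefmx_mxF_nat y n).
  exact: mcoef_conj_sub.
apply: subspace_sum => // a _; have lt_an := ltn_ord a.
have [d dE] : exists d, (n - a)%N = d.+1 by exists (n - a).-1; lia.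
have jE : j - d.+1%:Z = a%:Z - M%:Z by lia.
by rewrite dE; have := VA d; rewrite jE An.
Qed.

End LaurentMatrices.

(** * Descent along a central filtration *)

Section Descent.
Variables (k : closedFieldType) (N : nat).
Hypothesis char0 : [pchar k] =i pred0.
Implicit Types (A B : 'M[laurent k]_N) (x y C : 'M[pseries k]_N) (X Y D : 'M[k]_N).
Implicit Types (V W u : set 'M[k]_N).

(** In x D x^-1 - D = (x - 1) D x^-1 - D x^-1 (x - 1) both terms are divisible by t^(K+1). *)
Lemma mcoef_conj_small K x D n : mcoef x 0 = 1%:M -> zero_below K.+1 (x - 1%:M) ->
  (n < K)%N -> mcoef (x *m cmx D *m invmx x) n.+1 = 0.
Proof.
move=> x0 x1 lt_nK; have ux := unitps_mx x0.
have -> : x *m cmx D *m invmx x = cmx D + ((x - 1%:M) *m (cmx D *m invmx x)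
                                  - cmx D *m invmx x *m (x - 1%:M)).
  rewrite mulmxBl mulmxBr mul1mx mulmx1 mulmxKV // !mulmxA opprB.
  by rewrite subrKA addrC subrK.
rewrite mcoefD mcoefB mcoef_cmx add0r (zero_below_mulr _ x1) //.
by rewrite (zero_below_mull _ x1) // subrr.
Qed.

Lemma coefmx_conjF_small K x A (m j : int) : mcoef x 0 = 1%:M ->
    zero_below K.+1 (x - 1%:M) -> (forall i : int, i < m -> coefmx A i = 0) ->
  j < K%:Z + 1 + m -> coefmx (conjF x A) j = coefmx A j.
Proof.
move=> x0 x1 Am lt_j; apply/eqP; rewrite -subr_eq0; apply/eqP.
apply: (coefmx_conjF_mod (@subspace_zero k N N) x0) => n /=.
case: (ltnP n K) => [lt_nK|le_Kn]; first exact: mcoef_conj_small x1 lt_nK.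
by rewrite Am; [rewrite /cmx raddf0 mulmx0 mul0mx mcoef0 | lia].
Qed.

(** Conjugating D/t contributes the t^(n+1) coefficient of x D x^-1 to order n, and x' x^-1
    contributes C_n; the pole itself is unchanged. *)
Lemma coefmx_gauge_pole x C D A : mcoef x 0 = 1%:M -> mxD x = C *m x ->
  exists A', [/\ gauge (mxF x) (tmx (-1) D + A) = tmx (-1) D + A',
    forall j : int, j < 0 -> coefmx A' j = coefmx (conjF x A) j
  & forall n : nat, coefmx A' n%:Z =
      mcoef (x *m cmx D *m invmx x) n.+1 + mcoef C n + coefmx (conjF x A) n%:Z].
Proof.
move=> x0 xC; have ux := unitps_mx x0.
have [P [PE Pdef]] : exists P : 'M[laurent k]_N,
    (forall j : int, coefmx P j = coefmx (mxF (x *m cmx D *m invmx x)) (j + 1)) /\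
    P = conjF x (tmx (-1) D).
  exists (conjF x (tmx (-1) D)); split=> // j.
  by rewrite tmxE conjF_lmon coefmx_lmon opprK.
have sumE (a b c d : 'M[laurent k]_N) (j : int) : coefmx (a - b + c + d) j =
    coefmx a j - coefmx b j + coefmx c j + coefmx d j.
  by rewrite !coefmxD coefmxN.
exists (P - tmx (-1) D + mxF C + conjF x A); split.
- rewrite (gaugeE _ ux) xC mulmxK // (conjFD x (tmx (-1) D)) -Pdef.
  by rewrite !addrA [tmx _ _ + P]addrC addrK addrAC.
- move=> j lt_j0; rewrite sumE PE !coefmx_mxF coefmx_tmx.
  rewrite (lt_geF lt_j0) addr0; case: eqP => [->|ne].
    by rewrite /= (mcoef_conj0 x0) subrr add0r.
  by rewrite ifF ?subrr ?add0r //; lia.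
- move=> n; rewrite sumE PE coefmx_tmx /= subr0.
  rewrite (coefmx_mxF_nat C) (_ : n%:Z + 1 = n.+1%:Z) ?(coefmx_mxF_nat _ n.+1) //.
  by rewrite -addn1 PoszD.
Qed.

(** Since brackets of W with u fall into V, conjugation by x moves A only inside V, and modulo V
    order n changes by C_n + [C_n, D]/(n+1). Choosing C to make this equal to B_n - A_n achieves
    congruence modulo V. The contact order may drop from K to K+1+m, because x = 1 mod t^(K+1) while
    A starts at t^m. *)
Lemma descent_step W V u (K : nat) (m : int) D A B :
    subspace V -> subspace W -> subspace u ->
    (forall X, W X -> u X) -> (forall X, V X -> u X) ->
    (forall X Y, W X -> u Y -> V (bracket X Y)) ->
    (forall X, W X -> W (bracket D X)) ->
    (forall n Y, (K <= n)%N -> W Y -> bracket D Y = n.+1%:R *: Y -> Y = 0) ->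
    (forall j, u (coefmx A j)) -> (forall j : int, j < m -> coefmx A j = 0) ->
    m <= K%:Z -> (forall j, W (coefmx A j - coefmx B j)) ->
    (forall j : int, j < K%:Z -> coefmx A j = coefmx B j) ->
  exists x A', [/\ integral_curve W K x,
    gauge (mxF x) (tmx (-1) D + A) = tmx (-1) D + A',
    (forall j, u (coefmx A' j)) /\ (forall j : int, j < m -> coefmx A' j = 0),
    forall j, V (coefmx A' j - coefmx B j)
  & forall j : int, j < K%:Z -> j < K%:Z + 1 + m -> coefmx A' j = coefmx B j].
Proof.
move=> sV sW su Wu Vu WuV DW inj Au Am le_mK WAB ABK.
have /choice[c cP] (n : nat) : exists c, [/\ W c,
    c + n.+1%:R^-1 *: bracket c D = coefmx B n%:Z - coefmx A n%:Z
  & (n < K)%N -> c = 0].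
  case: (ltnP n K) => [lt_nK|le_Kn].
    exists 0; split=> //; first by case: sW.
    by rewrite ABK // subrr bracket0l scaler0 addr0.
  have WE : W (coefmx B n%:Z - coefmx A n%:Z).
    by rewrite -opprB; apply: subspaceN.
  have [Y WY YE] := bracket_solve sW DW (fun Y => inj n Y le_Kn) WE.
  (* With c = (n+1) Y the equation reads (n+1) Y - [D, Y] = B_n - A_n, which [bracket_solve]
     solves. *)
  exists (n.+1%:R *: Y); split=> //; first exact: subspaceZ.
  rewrite bracketZl scalerA mulVf ?natr_neq0 // scale1r -YE.
  by rewrite bracketC.
pose C : 'M[pseries k]_N := \matrix_(a, b) PSeries (fun n => c n a b).
have CE n : mcoef C n = c n by apply/matrixP => a b; rewrite !mxE.
have [x [x0 xC]] := ode_solution char0 C.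
have ix : integral_curve W K x.
  split=> //; exists C; split=> // [n|j lt_j]; rewrite CE; first by case: (cP n).
  by case: (cP j) => _ _; apply.
have x1 := integral_curve_cong char0 ix.
have WC i : W (mcoef C i) by rewrite CE; case: (cP i).
have [A' [gA' A'N A'P]] := coefmx_gauge_pole D A x0 xC.
have CuV i Y : u Y -> V (bracket (mcoef C i) Y) by apply: WuV.
have AV j : V (coefmx (conjF x A) j - coefmx A j).
  apply: (coefmx_conjF_mod sV x0) => n.
  by apply: (mcoef_conj_in char0 x0 xC sV) => [i|i Y /Vu uY]; apply: CuV.
have uconj n : u (mcoef (x *m cmx D *m invmx x) n.+1).
  apply: (mcoef_conj_in char0 x0 xC su) => [i|i Y uY]; last by apply/Vu/CuV.
  by rewrite bracketC; apply: (subspaceN su); apply/Wu/DW.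
have Qu j : u (coefmx (conjF x A) j).
  by rewrite -[X in u X](subrK (coefmx A j)); apply: subspaceD => //; apply: Vu.
have Qsmall j : j < K%:Z + 1 + m -> coefmx (conjF x A) j = coefmx A j.
  exact: coefmx_conjF_small.
have Psmall n : (n < K)%N -> mcoef (x *m cmx D *m invmx x) n.+1 + mcoef C n = 0.
  move=> lt_nK; rewrite (mcoef_conj_small D x0 x1 lt_nK) CE add0r.
  by case: (cP n) => _ _; apply.
exists x, A'; split=> //.
- split=> j; case: (ltP j 0) => [lt_j0|le_0j].
  + by rewrite A'N.
  + rewrite -[j]gez0_abs // A'P; apply: subspaceD => //.
    by apply: subspaceD => //; apply: Wu.
  + by move=> lt_jm; rewrite A'N // Qsmall ?Am //; lia.
  + rewrite -[j]gez0_abs // => lt_jm; rewrite A'P Psmall ?add0r; last lia.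
    by rewrite Qsmall ?Am //; lia.
- move=> j; case: (ltP j 0) => [lt_j0|le_0j].
    by rewrite A'N // -ABK //; lia.
  rewrite -[j]gez0_abs // A'P; set n := absz j.
  have [_ cE _] := cP n; rewrite -CE in cE.
  have := mcoef_conj_mod char0 x0 xC sV uconj CuV n => Vn.
  (* Substituting the equation for c_n leaves two errors: the higher-order part of x D x^-1 and the
     displacement of A, both in V. *)
  have -> : mcoef (x *m cmx D *m invmx x) n.+1 + mcoef C n + coefmx (conjF x A) n
      - coefmx B n =
      mcoef (x *m cmx D *m invmx x) n.+1 - n.+1%:R^-1 *: bracket (mcoef C n) D
      + (coefmx (conjF x A) n - coefmx A n).
    have -> : coefmx B n = mcoef C n + n.+1%:R^-1 *: bracket (mcoef C n) D + coefmx A n.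
      by rewrite cE subrK.
    have zid (a b e f g : 'M[k]_N) : a + b + e - (b + f + g) = a - f + (e - g).
      by rewrite (addrAC a b e) -(addrA b f g) addrKA opprD addrACA.
    exact: zid.
  by apply: subspaceD => //; apply: AV.
- move=> j lt_jK lt_j; case: (ltP j 0) => [lt_j0|le_0j].
    by rewrite A'N // Qsmall // ABK.
  move: lt_jK lt_j; rewrite -[j]gez0_abs // => lt_jK lt_j.
  by rewrite A'P Psmall ?add0r ?Qsmall ?ABK.
Qed.

(** Each step loses at most delta orders of contact, and every step must start at contact K0 or more
    so that no eigenvalue obstructs. After the last step the difference lies in V 0 = 0, whatever
    the contact, so i steps pay for only i - 1 losses. *)
Lemma gauge_descent (V : nat -> set 'M[k]_N) u D (K0 delta : nat) (m : int) :
    (forall i, subspace (V i)) -> subalgebra u -> (forall X, V 0%N X -> X = 0) ->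
    (forall i X, V i X -> u X) ->
    (forall i X Y, V i.+1 X -> u Y -> V i (bracket X Y)) ->
    (forall i X, V i X -> V i (bracket D X)) ->
    (forall n Y, (K0 <= n)%N -> u Y -> bracket D Y = n.+1%:R *: Y -> Y = 0) ->
    m <= K0%:Z -> - delta%:Z <= m + 1 ->
  forall i (K : nat) A B,
    (forall j, u (coefmx A j)) -> (forall j : int, j < m -> coefmx A j = 0) ->
    (forall j, V i (coefmx A j - coefmx B j)) ->
    ((0 < i)%N -> (i.-1 * delta + K0 <= K)%N /\
       forall j : int, j < K%:Z -> coefmx A j = coefmx B j) ->
  exists2 x, integral_curve u K0 x &
    gauge (mxF x) (tmx (-1) D + A) = tmx (-1) D + B.
Proof.
move=> sV [su uu] V0 Vu VuV DV inj le_m le_delta; elim=> [|i IHi] K A B Au Am VAB hK.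
  have -> : A = B.
    by apply: coefmxP => j; apply/eqP; rewrite -subr_eq0; apply/eqP/V0.
  by exists 1%:M; [apply: integral_curve1; case: su | rewrite gauge1].
have [//|le_K ABK] := hK.
have K0K : (K0 <= K)%N by apply: leq_trans le_K; apply: leq_addl.
have [||x [A' [ix gx [A'u A'm] VA'B A'B]]] := @descent_step (V i.+1) (V i) u K m D A B
  (sV i) (sV i.+1) su (Vu i.+1) (Vu i) (VuV i) (DV i.+1) _ Au Am _ VAB ABK.
- by move=> n Y le_Kn /Vu; apply: inj; apply: leq_trans le_Kn.
- by apply: le_trans le_m _; rewrite lez_nat.
(* A' and B agree below both K and K+1+m, hence below K - delta. *)
have [i_gt0|y iy gy] := IHi (K - delta)%N A' B A'u A'm VA'B.
  have iE : (i * delta = i.-1 * delta + delta)%N.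
    by rewrite -{1}(prednK i_gt0) mulSn addnC.
  move: le_K; rewrite /= iE => le_K; split=> [|j lt_j]; first by lia.
  have le_dK : (delta <= K)%N.
    by apply: leq_trans le_K; rewrite -addnA addnCA leq_addr.
  by apply: A'B; move: lt_j le_delta le_dK; clear; lia.
have ix' : integral_curve u K0 x by apply: integral_curve_sub ix => //; apply: Vu.
exists (y *m x); first exact: (integral_curveM char0 (conj su uu)).
by rewrite (gaugeM _ (integral_curve_unit iy) (integral_curve_unit ix)) gx.
Qed.

End Descent.

(** * Weights and eigenvalues *)

Section LaurentPolynomials.
Variable k : closedFieldType.
Hypothesis char0 : [pchar k] =i pred0.
Implicit Types (phi psi : k -> k) (P Q : {poly k}).

Lemma natr_inj : injective (fun n : nat => n%:R : k).
Proof.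
move=> a b; wlog le_ab : a b / (a <= b)%N => [IH e|/eqP].
  by case/orP: (leq_total a b) => le; [apply: IH | apply/esym/IH].
rewrite eq_sym -subr_eq0 -natrB // (pcharf0P k).1 // subn_eq0 => le_ba.
by apply/eqP; rewrite eqn_leq le_ab.
Qed.

(** In characteristic 0 the elements 1, 2, 3, ... supply more nonzero roots than the degree
    allows. *)
Lemma poly_eq_off0 P Q : (forall s, s != 0 -> P.[s] = Q.[s]) -> P = Q.
Proof.
move=> ePQ; apply/eqP; rewrite -subr_eq0; apply/negPn/negP => nz.
pose rs := [seq i.+1%:R : k | i <- iota 0 (size (P - Q))].
have := @max_poly_roots _ (P - Q) rs nz.
rewrite size_map size_iota ltnn => H; suff : false by []; apply: H.
  apply/allP => _ /mapP[i _ ->]; rewrite /root hornerD hornerN ePQ ?subrr //.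
  by rewrite natr_neq0.
by rewrite map_inj_uniq ?iota_uniq // => a b /natr_inj [].
Qed.

(* d is the derivative at 1 of the Laurent polynomial function phi. *)
Definition ldiff phi (d : k) : Prop := exists P e,
  laurent_poly_rep phi P e /\ d = P^`().[1] - e%:R * P.[1].

Lemma ldiff_ext phi psi d : (forall s, s != 0 -> phi s = psi s) ->
  ldiff phi d -> ldiff psi d.
Proof.
move=> ext [P [e [rP ->]]]; exists P, e; split=> // s s0.
by rewrite -ext // rP.
Qed.

(** Two representations give the polynomial identity P X^f = Q X^e; comparing derivatives at 1 gives
    the result. *)
Lemma ldiff_uniq phi d d' : ldiff phi d -> ldiff phi d' -> d = d'.
Proof.
move=> [P [e [rP ->]]] [Q [f [rQ ->]]].
have PQ : P * 'X^f = Q * 'X^e.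
  apply: poly_eq_off0 => s s0; rewrite !hornerM !hornerXn.
  have sX i : s ^+ i != 0 by rewrite expf_neq0.
  by have := rP s s0; rewrite rQ // => /eqP; rewrite eqr_div // => /eqP.
have := congr1 (fun R => R.[1]) PQ.
rewrite !hornerM !hornerXn !expr1n !mulr1 => PQ1.
have := congr1 (fun R => R^`().[1]) PQ.
rewrite !derivM !hornerD !hornerM !derivXn !hornerMn !hornerXn !expr1n !mulr1.
rewrite PQ1 => E.
by rewrite -(addrK (Q.[1] * f%:R) P^`().[1]) E; ring.
Qed.

Lemma ldiff_const c : ldiff (fun=> c) 0.
Proof.
exists c%:P, 0%N; split; first by move=> s _; rewrite hornerC divr1.
by rewrite derivC horner0 mul0r subrr.
Qed.

Lemma ldiffD phi psi d d' : ldiff phi d -> ldiff psi d' ->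
  ldiff (fun s => phi s + psi s) (d + d').
Proof.
move=> [P [e [rP ->]]] [Q [f [rQ ->]]].
exists (P * 'X^f + Q * 'X^e), (e + f)%N; split=> [s s0|].
  have sX i : s ^+ i != 0 by rewrite expf_neq0.
  rewrite rP // rQ // !hornerE exprD; field.
  by rewrite !sX.
rewrite derivD !derivM !hornerD !hornerM !derivXn !hornerMn !hornerXn !expr1n !mulr1.
by rewrite natrD; ring.
Qed.

Lemma ldiffM phi psi d d' : ldiff phi d -> ldiff psi d' ->
  ldiff (fun s => phi s * psi s) (d * psi 1 + phi 1 * d').
Proof.
move=> [P [e [rP ->]]] [Q [f [rQ ->]]].
exists (P * Q), (e + f)%N; split=> [s s0|].
  have sX i : s ^+ i != 0 by rewrite expf_neq0.
  by rewrite rP // rQ // hornerM exprD; field; rewrite !sX.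
rewrite derivM hornerD !hornerM rP ?oner_neq0 // rQ ?oner_neq0 // !expr1n !divr1.
by rewrite natrD; ring.
Qed.

Lemma ldiff_sum (I : finType) (phi : I -> k -> k) (d : I -> k) :
  (forall i, ldiff (phi i) (d i)) -> ldiff (fun s => \sum_i phi i s) (\sum_i d i).
Proof.
move=> H; elim: (index_enum I) => [|i r IHr].
  by rewrite big_nil; apply: ldiff_ext (ldiff_const 0) => s _; rewrite big_nil.
by rewrite big_cons; apply: ldiff_ext (ldiffD (H i) IHr) => s _; rewrite big_cons.
Qed.

Lemma ldiff_exprz (n : int) : ldiff (fun s => s ^ n) n%:~R.
Proof.
case: n => n.
  exists 'X^n, 0%N; split=> [s _|]; first by rewrite hornerXn divr1.
  by rewrite derivXn hornerMn !hornerXn !expr1n mul0r subr0.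
exists 1, n.+1; split=> [s _|]; first by rewrite hornerC mul1r.
by rewrite derivC horner0 hornerC mulr1 sub0r.
Qed.

(** Existence of d only records that phi has a representation P(s) / s^e. *)
Definition is_laurent phi := exists d, ldiff phi d.

Lemma is_laurent_inv phi : is_laurent phi -> is_laurent (fun s => phi s^-1).
Proof.
move=> [_ [P [e [rP _]]]].
have H : is_laurent (fun s => \sum_(i < size P) P`_i * (s ^ (- i%:Z) * s ^ e%:Z)).
  eexists; apply: ldiff_sum => i; apply: ldiffM; first exact: ldiff_const.
  by apply: ldiffM; apply: ldiff_exprz.
have [d dE] := H; exists d; apply: ldiff_ext dE => s s0.
rewrite rP ?invr_eq0 // horner_coef mulr_suml; apply: eq_bigr => i _.
by rewrite !exprVn invrK exprnN mulrA.
Qed.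

(** Once its zero at 0 is removed, the numerator has no root in an algebraically closed field, so it
    is constant, equal to 1 by the value at 1. *)
Lemma laurent_nonvanishing phi : is_laurent phi -> phi 1 = 1 ->
  (forall s, s != 0 -> phi s != 0) ->
  exists e : int, forall s, s != 0 -> phi s = s ^ e.
Proof.
move=> [_ [P [e [rP _]]]] phi1 phi0.
have [m [Q Q0 PE]] := multiplicity_XsubC P 0; rewrite subr0 in PE.
have P1 : P.[1] = 1 by have := rP 1 (oner_neq0 _); rewrite phi1 expr1n divr1.
have Pn0 : P != 0.
  by apply/eqP => P0; move/eqP: P1; rewrite P0 horner0 eq_sym oner_eq0.
rewrite Pn0 /= in Q0.
have /size_poly1P[c c0 QE] : size Q == 1%N.
  apply/negPn/negP => /closed_rootP[a Qa].
  have a0 : a != 0 by apply: contraNneq Q0 => <-.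
  have := phi0 _ a0; rewrite rP // PE hornerM (rootP Qa) !mul0r eqxx.
  by [].
have c1 : c = 1 by move: P1; rewrite PE QE hornerM hornerC hornerXn expr1n mulr1.
exists (m%:Z - e%:Z) => s s0; rewrite rP // PE QE c1 hornerM hornerC hornerXn mul1r.
by rewrite expfzDr // -exprnN.
Qed.

(** It suffices to test s = 2, which has infinite multiplicative order in characteristic 0. *)
Lemma exprz_inj (a b : int) : (forall s : k, s != 0 -> s ^ a = s ^ b) -> a = b.
Proof.
move=> eab; have n2 : 2%:R != 0 :> k by rewrite natr_neq0.
suff pow1 (n : nat) : 2%:R ^+ n = 1 :> k -> n = 0%N.
  have /eqP := eab _ n2; rewrite -subr_eq0 => /eqP E.
  have : 2%:R ^ (a - b) = 1 :> k.
    rewrite expfzDr // -invr_expz eab // mulfV // expfz_neq0 //.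
  case e : (a - b) => [n|n]; first by move/pow1; lia.
  by move=> /(congr1 GRing.inv); rewrite invrK invr1 => /pow1; lia.
rewrite -natrX -[1]/(1%:R) => /natr_inj; case: n => // n.
by rewrite expnS; have := expn_gt0 2 n; lia.
Qed.

End LaurentPolynomials.

(** * Common eigenvectors of commuting operators *)

Section CommonEigenvector.
Variables (k : closedFieldType) (vT : vectType k).
Implicit Types (E : {vspace vT}) (f g : 'End(vT)).

(** The characteristic polynomial of f on a basis of E has positive degree, hence a root; the row
    eigenvector gives the coordinates of v. *)
Lemma stable_eigenvector E f : E != 0%VS -> (f @: E <= E)%VS ->
  exists a v, [/\ v \in E, v != 0 & f v = a *: v].
Proof.
move=> E0 fE; pose b := vbasis E.
have bE i : b`_i \in E.
  have [lt_i|le_i] := ltnP i (size b); first exact/vbasis_mem/mem_nth.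
  by rewrite nth_default ?mem0v.
pose M : 'M[k]_(\dim E) := \matrix_(i, j) coord b j (f b`_i).
have /closed_rootP[a] : size (char_poly M) != 1.
  by rewrite size_char_poly eqSS dimv_eq0.
rewrite -eigenvalue_root_char => /eigenvalueP[w wM w0].
exists a, (\sum_i w 0 i *: b`_i); split.
- by apply: memv_suml => i _; apply: memvZ.
- apply: contra_neq w0 => sum0; apply/rowP => i; rewrite mxE.
  by have /freeP := basis_free (vbasisP E); apply.
- rewrite linear_sum /= scaler_sumr.
  have fb (i : 'I_(\dim E)) : f b`_i = \sum_j M i j *: b`_j.
    have fbE : f b`_i \in E by apply: subvP fE _ (memv_img f (bE i)).
    by rewrite {1}(coord_vbasis fbE); apply: eq_bigr => j _; rewrite mxE.
  under eq_bigr do rewrite linearZ /= fb scaler_sumr.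
  rewrite exchange_big; apply: eq_bigr => j _.
  have := congr1 (fun u : 'rV_(\dim E) => u 0 j) wM; rewrite !mxE scalerA => <-.
  by rewrite scaler_suml; apply: eq_bigr => i _; rewrite /= scalerA.
Qed.

(** Induction on dim E, valid for infinite families: if some operator of F is not scalar on E, one
    of its eigenspaces in E is nonzero, proper, and stable under F by commutation. *)
Lemma common_eigenvector_set (F : set 'End(vT)) E : E != 0%VS ->
    (forall f, F f -> (f @: E <= E)%VS) ->
    (forall f g v, F f -> F g -> f (g v) = g (f v)) ->
  exists v, [/\ v \in E, v != 0 & forall f, F f -> exists a, f v = a *: v].
Proof.
move=> + + FC; have [d] := ubnP (\dim E); elim: d => // d IHd in E *.
rewrite ltnS => le_d E0 FE.
have [scal|] := pselect (forall f, F f -> exists a, forall v, v \in E -> f v = a *: v).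
  exists (vpick E); split; first exact: memv_pick; first by rewrite vpick0.
  by move=> f /scal[a fa]; exists a; apply/fa/memv_pick.
move/existsNP => [f /not_implyP[Ff nscal]].
have [a [w [wE w0 fw]]] := stable_eigenvector E0 (FE f Ff).
pose E' := (E :&: lker (f - a *: \1%VF))%VS.
have mem' v : (v \in E') = (v \in E) && (f v == a *: v).
  by rewrite memv_cap memv_ker add_lfunE opp_lfunE scale_lfunE id_lfunE subr_eq0.
have [|||v [vE' v0 Fv]] := IHd E'.
- apply: leq_trans le_d; rewrite ltn_neqAle dimvS ?capvSl // andbT.
  apply/eqP => eq_dim; case: nscal; exists a => v vE.
  have /eqP E'E : E' == E by rewrite eqEdim capvSl eq_dim leqnn.
  by move: vE; rewrite -E'E mem' => /andP[_ /eqP].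
- by apply: contra_neq w0 => E'0; apply/eqP; rewrite -memv0 -E'0 mem' wE fw eqxx.
- move=> g Fg; apply/subvP => _ /memv_imgP[v vE' ->].
  move: vE'; rewrite mem' => /andP[vE /eqP fv].
  rewrite mem' FC // fv linearZ eqxx andbT.
  exact: subvP (FE g Fg) _ (memv_img g vE).
- by exists v; split=> //; move: vE'; rewrite mem' => /andP[].
Qed.

End CommonEigenvector.

(** * Cocharacters acting on a weight vector *)

Section EigenvalueBound.
Variables (k : closedFieldType) (N : nat).
Hypothesis char0 : [pchar k] =i pred0.
Implicit Types (A X Y D : 'M[k]_N) (lam : k -> 'M[k]_N).

(** [cochar_diff] is [ldiff] entry by entry, so the product rule applies to each summand of a matrix
    product. *)
Lemma cochar_diffMl A lam D : cochar_diff lam D ->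
  forall i j, ldiff (fun s => (A *m lam s) i j) ((A *m D) i j).
Proof.
move=> lamD i j; rewrite mxE.
have H a : ldiff (fun s => A i a * lam s a j) (0 * lam 1 a j + A i a * D a j).
  by apply: ldiffM (lamD a j); apply: ldiff_const.
have := ldiff_sum H; under eq_bigr do rewrite mul0r add0r.
by apply: ldiff_ext => s _; rewrite mxE.
Qed.

Lemma cochar_diffMr A lam D : cochar_diff lam D ->
  forall i j, ldiff (fun s => (lam s *m A) i j) ((D *m A) i j).
Proof.
move=> lamD i j; rewrite mxE.
have H a : ldiff (fun s => lam s i a * A a j) (D i a * A a j + lam 1 i a * 0).
  by apply: (ldiffM (lamD i a) (ldiff_const (A a j))).
have := ldiff_sum H; under eq_bigr do rewrite mulr0 addr0.
by apply: ldiff_ext => s _; rewrite mxE.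
Qed.

Variable T : set 'M[k]_N.
Hypothesis Tu : forall g, T g -> g \in unitmx.
Hypothesis TC : forall g h, T g -> T h -> g *m h = h *m g.

Lemma cochar1 lam : cocharacter T lam -> lam 1 = 1%:M.
Proof.
move=> [lamT lamM _]; have u1 := Tu (lamT 1 (oner_neq0 _)).
have := lamM 1 1 (oner_neq0 _) (oner_neq0 _); rewrite mulr1.
by move=> /(congr1 (mulmx (invmx (lam 1)))); rewrite mulmxA mulVmx // mul1mx.
Qed.

Lemma cocharV lam s : cocharacter T lam -> s != 0 -> invmx (lam s) = lam s^-1.
Proof.
move=> clam s0; have [lamT lamM _] := clam; have us := Tu (lamT s s0).
have := lamM s s^-1 s0; rewrite invr_eq0 mulfV // (cochar1 clam) => /(_ s0) E.
by rewrite -[LHS]mulmx1 E mulmxA mulVmx // mul1mx.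
Qed.

(** Differentiate g lam(s) = lam(s) g at s = 1. *)
Lemma cochar_diff_comm lam D g : cocharacter T lam -> cochar_diff lam D -> T g ->
  g *m D = D *m g.
Proof.
move=> [lamT _ _] lamD Tg; apply/matrixP => i j.
apply: (ldiff_uniq char0 (cochar_diffMl g lamD i j)).
by apply: ldiff_ext (cochar_diffMr g lamD i j) => s s0; rewrite (TC Tg (lamT s s0)).
Qed.

Section Eigenvector.
Variables (X : 'M[k]_N) (chi : 'M[k]_N -> k).
Hypothesis X0 : X != 0.
Hypothesis Xchi : forall g, T g -> g *m X *m invmx g = chi g *: X.

Lemma exists_entry : exists i j, X i j != 0.
Proof.
apply: contrapT => nX; case/eqP: X0; apply/matrixP => i j; rewrite mxE.
by apply/eqP/negPn/negP => Xij; apply: nX; exists i, j.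
Qed.

Lemma eigen_char_neq0 g : T g -> chi g != 0.
Proof.
move=> Tg; apply: contra_neq X0 => chi0; have ug := Tu Tg.
have := Xchi Tg; rewrite chi0 scale0r => /(congr1 (mulmx^~ g)).
rewrite mulmxKV // mul0mx => /(congr1 (mulmx (invmx g))).
by rewrite mulmxA mulVmx // mul1mx mulmx0.
Qed.

Lemma eigen_char_commute g : T g -> g *m X = chi g *: (X *m g).
Proof.
by move=> Tg; rewrite scalemxAl -Xchi // mulmxKV // Tu.
Qed.

Lemma eigen_charM g h : T g -> T h -> T (g *m h) -> chi (g *m h) = chi g * chi h.
Proof.
move=> Tg Th Tgh; have := eigen_char_commute Tgh.
rewrite -mulmxA (eigen_char_commute Th) -scalemxAr (mulmxA g X h) (eigen_char_commute Tg).
rewrite -scalemxAl scalerA -(mulmxA X) [chi h * _]mulrC => /esym/eqP.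
rewrite -subr_eq0 -scalerBl scaler_eq0 subr_eq0 => /orP[/eqP //|].
move=> /eqP /(congr1 (mulmx^~ (invmx (g *m h)))); rewrite mulmxK ?Tu // mul0mx.
by move/eqP; rewrite (negbTE X0).
Qed.

(** At a nonzero entry X_ij, chi(lam(s)) is the (i, j) entry of lam(s) X lam(s)^-1 divided by X_ij.
    It is thus a Laurent polynomial without zeros, equal to 1 at s = 1, and [laurent_nonvanishing]
    applies. *)
Lemma eigen_cochar_exponent lam : cocharacter T lam ->
  exists e : int, forall s, s != 0 -> chi (lam s) = s ^ e.
Proof.
move=> clam; have [lamT lamM lamL] := clam.
have [i [j Xij]] := exists_entry.
apply: (@laurent_nonvanishing k (fun s => chi (lam s))).
- have ent a b : is_laurent (fun s => lam s a b).
    by have [P [e r]] := lamL a b; exists (P^`().[1] - e%:R * P.[1]), P, e.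
  have is_sum (phi : 'I_N -> k -> k) : (forall a, is_laurent (phi a)) ->
      is_laurent (fun s => \sum_a phi a s).
    by move=> /choice[d dP]; exists (\sum_a d a); apply: ldiff_sum.
  have isM phi psi : is_laurent phi -> is_laurent psi ->
      is_laurent (fun s : k => phi s * psi s).
    by move=> [d dP] [e eP]; eexists; apply: ldiffM dP eP.
  have isC c : is_laurent (fun=> c : k) by exists 0; apply: ldiff_const.
  have [d dP] : is_laurent (fun s => (X i j)^-1 *
      \sum_a (\sum_c lam s i c * X c a) * lam s^-1 a j).
    apply: (isM _ _ (isC _)); apply: (is_sum _) => a.
    apply: (isM _ _ _ (is_laurent_inv (ent a j))); apply: (is_sum _) => c.
    exact: (isM _ _ (ent i c) (isC _)).
  exists d; apply: ldiff_ext dP => s s0.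
  have := congr1 (fun A : 'M_N => A i j) (Xchi (lamT s s0)).
  rewrite (cocharV clam s0) [RHS]mxE => E.
  have -> : \sum_a (\sum_c lam s i c * X c a) * lam s^-1 a j =
            (lam s *m X *m lam s^-1) i j.
    by rewrite [RHS]mxE; apply: eq_bigr => a _; rewrite [in RHS]mxE.
  by rewrite E mulrC mulfK.
- rewrite (cochar1 clam).
  have T1 : T 1%:M by rewrite -(cochar1 clam); apply/lamT/oner_neq0.
  have := eigen_charM T1 T1; rewrite mulmx1 => /(_ T1) /eqP.
  rewrite -{1}[chi _]mulr1 => /eqP /(mulfI (eigen_char_neq0 T1)) //.
- by move=> s s0; apply/eigen_char_neq0/lamT.
Qed.

(** Differentiating lam(s) X = s^e X lam(s) at s = 1 gives D X = e X + X D. *)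
Lemma eigen_cochar_diff lam D (e : int) : cocharacter T lam -> cochar_diff lam D ->
  (forall s, s != 0 -> chi (lam s) = s ^ e) -> bracket D X = e%:~R *: X.
Proof.
move=> clam lamD chie; have [lamT _ _] := clam; apply/matrixP => i j.
have := ldiffM (ldiff_exprz k e) (cochar_diffMl X lamD i j).
rewrite exp1rz (cochar1 clam) mulmx1 mul1r => dR.
have := ldiff_uniq char0 (cochar_diffMr X lamD i j).
move=> /(_ (e%:~R * X i j + (X *m D) i j)) E.
rewrite [LHS]mxE [in X in _ + X]mxE [RHS]mxE E ?addrK //.
apply: ldiff_ext dR => s s0.
by rewrite (eigen_char_commute (lamT s s0)) chie // [RHS]mxE.
Qed.

End Eigenvector.
End EigenvalueBound.

(** * Integer eigenvalues of ad D and the bound L *)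

Section WeightBound.
Variable k : closedFieldType.
Hypothesis char0 : [pchar k] =i pred0.
Variable pi : k -> rat.
Hypothesis pi_linear : forall (q : rat) (x y : k), pi (ratr q * x + y) = q * pi x + pi y.
Hypothesis pi1 : pi 1 = 1.

Lemma pi_add x y : pi (x + y) = pi x + pi y.
Proof.
have r1 : ratr 1 = 1 :> k := ratr_nat k 1.
by have := pi_linear 1 x y; rewrite r1 !mul1r.
Qed.
Lemma pi_zero : pi 0 = 0.
Proof. by apply: (addrI (pi 0)); rewrite -pi_add !addr0. Qed.
Lemma pi_mulz x (z : int) : pi (x * z%:~R) = pi x * z%:~R.
Proof. by rewrite mulrC -ratr_int -[X in pi X]addr0 pi_linear pi_zero addr0 mulrC. Qed.
Lemma pi_sum (I : finType) (F : I -> k) : pi (\sum_i F i) = \sum_i pi (F i).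
Proof. by elim/big_rec2: _ => [|i x y _ <-]; rewrite ?pi_zero ?pi_add. Qed.
Lemma pi_nat n : pi n%:R = n%:R.
Proof. by have := pi_mulz 1 n%:Z; rewrite !mul1r pi1 mul1r. Qed.

Variables (N : nat) (G T U : set 'M[k]_N).
Hypotheses (hG : linear_alggroup G) (hT : torus T) (hU : unipotent U).
Hypothesis hGTU : semidirect G T U.

(** The character is read off at a nonzero entry of X; it is regular because g X g^-1 = g X adj(g) /
    det g. *)
Lemma eigenvector_weight (X : 'M[k]_N) : X != 0 -> Lie U X ->
    (forall g, T g -> exists a, g *m X *m invmx g = a *: X) ->
  exists2 chi, weight T U chi & forall g, T g -> g *m X *m invmx g = chi g *: X.
Proof.
move=> X0 UX eigX; have [i [j Xij]] := exists_entry X0.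
have Tu g : T g -> g \in unitmx by case: hT => -[[_ _ _ Tu] _] _; apply: Tu.
have TM g h : T g -> T h -> T (g *m h) by case: hT => -[[_ TM _ _] _] _; apply: TM.
pose chi g := (g *m X *m invmx g) i j / X i j.
have Xchi g : T g -> g *m X *m invmx g = chi g *: X.
  by move=> /eigX[a Xa]; rewrite /chi Xa mxE mulfK.
exists chi => //; split; last by exists X.
split=> [g Tg|g h Tg Th|].
- exact: (eigen_char_neq0 Tu X0 Xchi Tg).
- exact: (eigen_charM Tu X0 Xchi Tg Th (TM _ _ Tg Th)).
exists ((generic_mx k N *m map_mx (@mpolyC _ k) X *m \adj (generic_mx k N)) i j
   * (X i j)^-1%:MP), 1%N => g Tg.
rewrite /mxeval mevalM mevalC /chi expr1 mulrAC; congr (_ / _).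
set ev := meval _.
have -> : ev ((generic_mx k N *m map_mx (@mpolyC _ k) X *m \adj (generic_mx k N)) i j) =
    (g *m X *m \adj g) i j.
  transitivity (map_mx ev (generic_mx k N *m map_mx (@mpolyC _ k) X *m \adj (generic_mx k N)) i j).
    by rewrite [RHS]mxE.
  rewrite !map_mxM map_mx_adj map_generic_mxk; congr ((_ *m _ *m _) i j).
  by apply/matrixP => a e; rewrite !mxE; apply: mevalC.
by rewrite /invmx (Tu _ Tg) -scalemxAr mxE mulrC.
Qed.

Variables (l : nat) (chi : 'I_l -> 'M[k]_N -> k) (b : nat) (D : 'M[k]_N).
Variable mu : k -> 'M[k]_N.
Hypotheses (hchi : weights_of T U chi) (b_gt0 : (0 < b)%N).
Hypotheses (hmu : cocharacter T mu) (hmu_pi : pi_ext_eq pi T b D mu).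

(** The eigenspace of ad D in Lie U is stable under the commuting operators Ad(g), g in T, so it
    contains a weight vector, of weight psi say. Writing D as a sum of c_i times differentials of
    cocharacters lam_i gives n+1 = sum of c_i <lam_i, psi>, and applying [pi] turns the right side
    into <mu, psi> / b. *)
Lemma eigenvalue_le_weights (Y : 'M[k]_N) n : Lie U Y -> Y != 0 ->
    bracket D Y = n.+1%:R *: Y ->
  n.+1%:R <= \big[Num.max/0]_(i < l) ((pairing mu (chi i))%:~R / b%:R) :> rat.
Proof.
move=> UY Y0 DY.
have Tu g : T g -> g \in unitmx by case: hT => -[[_ _ _ Tu] _] _; apply: Tu.
have T1 : T 1%:M by case: hT => -[[]].
have U1 : U 1%:M by case: hU => -[[]].
have Uu g : U g -> g \in unitmx by case: hU => -[[_ _ _ Uu] _] _; apply: Uu.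
have TC := torus_commute hT.
have [r [lam [Dl [c [clam dlam DE [d [nn [d_gt0 nnE prodE]]]]]]]] := hmu_pi.
(* D is a combination of differentials of cocharacters, hence fixed by Ad T; this makes the
   eigenspace stable. *)
have TD g : T g -> g *m D = D *m g.
  move=> Tg; rewrite DE mulmx_sumr mulmx_suml; apply: eq_bigr => i _.
  by rewrite -scalemxAr -scalemxAl (cochar_diff_comm char0 TC (clam i) (dlam i) Tg).
have sW : subspace [set X | Lie U X /\ bracket D X = n.+1%:R *: X].
  split=> [|a X Z [UX DX] [UZ DZ]] /=.
    by rewrite bracket0r scaler0; split=> //; case: (Lie_subspace U).
  split; first by case: (Lie_subspace U) => _; apply.
  by rewrite bracketDr bracketZr DX DZ scalerDr !scalerA mulrC.
have [W WE] := subspace_vspace sW.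
pose F : set 'End('M[k]_N) := fun f =>
  exists2 g, T g & forall X, f X = g *m X *m invmx g.
have conj_lin g : exists f : 'End('M[k]_N), forall X, f X = g *m X *m invmx g.
  have lin_g : linear (fun X : 'M[k]_N => g *m X *m invmx g).
    by move=> a X Z; rewrite mulmxDr mulmxDl -scalemxAr -scalemxAl.
  pose fl : {linear 'M[k]_N -> 'M[k]_N} :=
    HB.pack (fun X : 'M[k]_N => g *m X *m invmx g) (GRing.isLinear.Build _ _ _ _ _ lin_g).
  by exists (linfun fl) => X; rewrite lfunE.
have [|||X [/WE[UX DX] X0 FX]] := @common_eigenvector_set _ _ F W.
- by apply: contra_neq Y0 => W0; apply/eqP; rewrite -memv0 -W0; apply/WE.
- move=> f [g Tg fE]; apply/subvP => _ /memv_imgP[X /WE[UX DX] ->].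
  have ug := Tu g Tg; apply/WE; rewrite fE; split.
    apply: Lie_conj => // h Uh; case: hGTU => TG _ nU _ _.
    by apply: nU => //; apply: TG.
  have Dg' : invmx g *m D = D *m invmx g.
    by rewrite -[LHS](mulmxK ug) -[invmx g *m D *m g]mulmxA -(TD _ Tg) mulKmx.
  have -> : bracket D (g *m X *m invmx g) = g *m bracket D X *m invmx g.
    rewrite /bracket mulmxBr mulmxBl !mulmxA (TD _ Tg) -!mulmxA; congr (_ - _).
    by rewrite Dg'.
  by rewrite DX -scalemxAr -scalemxAl.
- move=> f f' X [g Tg fE] [g' Tg' fE']; have [ug ug'] := (Tu _ Tg, Tu _ Tg').
  rewrite !fE !fE' !mulmxA (TC _ _ Tg Tg') -!mulmxA; do 3! congr (_ *m _).
  by rewrite -!invmx_mul // (TC _ _ Tg Tg').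
have [|psi wpsi Xpsi] := eigenvector_weight X0 UX.
  move=> g Tg; have [f fE] := conj_lin g.
  by have [|a fa] := FX f; [exists g | exists a; rewrite -fE].
have [_ _ /(_ _ wpsi)[i0 psiE]] := hchi.
have /choice[e eE] (i : 'I_r) : exists e : int, forall s, s != 0 -> psi (lam i s) = s ^ e.
  exact: (eigen_cochar_exponent Tu X0 Xpsi (clam i)).
have nE : n.+1%:R = \sum_i c i * (e i)%:~R.
  apply/eqP; rewrite -subr_eq0; have : (n.+1%:R - \sum_i c i * (e i)%:~R) *: X = 0.
    apply/eqP; rewrite scalerBl -DX subr_eq0; apply/eqP.
    have -> : bracket D X = \sum_i c i *: bracket (Dl i) X.
      rewrite DE /bracket mulmx_sumr mulmx_suml -sumrB; apply: eq_bigr => i _.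
      by rewrite -scalemxAr -scalemxAl scalerBr.
    rewrite scaler_suml; apply: eq_bigr => i _.
    by rewrite (eigen_cochar_diff char0 Tu Xpsi (clam i) (dlam i) (eE i)) scalerA.
  by move/eqP; rewrite scaler_eq0 (negbTE X0) orbF.
pose pm := pairing mu (chi i0).
(* [pairing] chooses an exponent, with default 0; an exponent does exist here, so the choice is a
   genuine one. *)
have pmE s : s != 0 -> psi (mu s) = s ^ pm.
  have [muT _ _] := hmu.
  have [e0 e0E] := eigen_cochar_exponent Tu X0 Xpsi hmu.
  have ex : exists e : int, forall s, s != 0 -> chi i0 (mu s) = s ^ e.
    by exists e0 => t t0 /=; rewrite -psiE ?e0E //; apply: muT.
  by move=> s0; rewrite psiE ?(xgetPex 0 ex s s0) //; apply: muT.
(* Apply psi to the relation that expresses mu(s^d) as the product of the lam_i(s^(n_i)). *)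
have dpm : d%:Z * pm = \sum_i nn i * e i.
  apply: (exprz_inj char0) => s s0.
  rewrite -exprz_exp -pmE ?expf_neq0 // -prodE //.
  have [_ ->] : T (\big[mulmx/1%:M]_i lam i (s ^ nn i)) /\
      psi (\big[mulmx/1%:M]_i lam i (s ^ nn i)) = s ^ (\sum_i nn i * e i) => //.
  have psi1 : psi 1%:M = 1.
    have := eigen_charM Tu X0 Xpsi T1 T1; rewrite mulmx1 => /(_ T1) /eqP.
    rewrite -{1}[psi _]mulr1 => /eqP /(mulfI (eigen_char_neq0 Tu X0 Xpsi T1)).
    by [].
  elim/big_rec2: _ => [|i z A _ [TA psiA]]; first by rewrite psi1.
  have sn0 : s ^ nn i != 0 by rewrite expfz_neq0.
  have Tl : T (lam i (s ^ nn i)) by case: (clam i) => lT _ _; apply: lT.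
  have TM : T (lam i (s ^ nn i) *m A) by case: hT => -[[_ TM _ _] _] _; apply: TM.
  split=> //; rewrite (eigen_charM Tu X0 Xpsi Tl TA TM) eE // psiA.
  by rewrite exprz_exp expfzDr.
(* Here [pi] enters: n_i = d b pi(c_i), and [pi] fixes the integer n+1. *)
have bn : b%:R * n.+1%:R = pm%:~R :> rat.
  have d0 : d%:R != 0 :> rat by rewrite pnatr_eq0 -lt0n.
  apply: (mulfI d0).
  have := congr1 (fun z : int => z%:~R : rat) dpm.
  rewrite intrM -pmulrn => ->; rewrite rmorph_sum /=.
  rewrite -(pi_nat n.+1) nE pi_sum !mulr_sumr; apply: eq_bigr => i _.
  by rewrite pi_mulz intrM nnE !mulrA.
apply: (bigmax_sup i0) => //; rewrite -/pm -bn mulrC mulKf //.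
by rewrite pnatr_eq0 -lt0n.
Qed.

End WeightBound.

(** * The gauge transformations *)

Section Assembly.
Variable k : closedFieldType.
Hypothesis char0 : [pchar k] =i pred0.

Lemma base_change_coef N (V : set 'M[k]_N) (A : 'M[laurent k]_N) (j : int) :
  subspace V -> base_change V A -> V (coefmx A j).
Proof.
move=> sV [d [c [X [VX ->]]]].
have -> : coefmx (\sum_(i < d) c i *: map_mx (fun a => a%:A : laurent k) (X i)) j =
    \sum_(i < d) c i j *: X i.
  elim/big_rec2: _ => [|i Y Z _ <-]; first by apply/matrixP => a b; rewrite !mxE.
  rewrite coefmxD; congr (_ + _); apply/matrixP => a b; rewrite !mxE.
  by rewrite -scalerAr mulr1 -[LHS]/(_ * c i j) mulrC.
by apply: subspace_sum => // i _; apply: subspaceZ.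
Qed.

Lemma zero_below_eqmodt N (x : 'M[pseries k]_N) (e : nat) (e' : int) :
  zero_below e (x - 1%:M) -> e' <= e%:Z -> eqmodt e' (mxF x) 1%:M.
Proof.
move=> x1 le_e j lt_j.
have -> : 1%:M = mxF 1%:M :> 'M[laurent k]_N by rewrite /mxF map_mx1.
rewrite !coefmx_mxF; case: ifP => // le0; apply/eqP; rewrite -subr_eq0 -mcoefB.
by apply/eqP/x1; lia.
Qed.

Variables (N : nat) (G T U : set 'M[k]_N).
Hypotheses (hG : linear_alggroup G) (hT : torus T) (hU : unipotent U).
Hypothesis hGTU : semidirect G T U.
Implicit Types (A B Z : 'M[laurent k]_N) (x y : 'M[pseries k]_N) (D : 'M[k]_N).

Let TG X : Lie T X -> Lie G X. Proof. exact: Lie_T_G hGTU X. Qed.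
Let UG X : Lie U X -> Lie G X. Proof. exact: Lie_U_G hGTU X. Qed.

(** As Lie T is abelian, Ad(x) fixes A, so the gauge action just adds x' x^-1 = B - A. Conjugation
    by x preserves Lie U because Lie T normalizes it. *)
Lemma torus_gauge A B (q : nat) :
    (forall j, Lie T (coefmx A j)) -> (forall j, Lie T (coefmx B j)) ->
    (forall j : int, j < 0 -> coefmx A j = coefmx B j) ->
    (forall j : int, j < q%:Z -> coefmx A j = coefmx B j) ->
  exists x, [/\ integral_curve (Lie T) q x,
    forall Z, gauge (mxF x) (A + Z) = B + conjF x Z
  & forall Z, (forall j, Lie U (coefmx Z j)) -> forall j, Lie U (coefmx (conjF x Z) j)].
Proof.
move=> TA TB AB0 ABq.
(* B - A has no terms of negative order by [AB0], so keeping the nonnegative ones loses nothing. *)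
pose C : 'M[pseries k]_N := \matrix_(a, b) PSeries (fun n => coefmx (B - A) n%:Z a b).
have CE n : mcoef C n = coefmx B n%:Z - coefmx A n%:Z.
  by rewrite -coefmxB; apply/matrixP => a b; rewrite !mxE /= !mxE.
have TC n : Lie T (mcoef C n).
  by rewrite CE; apply: (subspaceB (Lie_subspace T)).
have [x [x0 xC]] := ode_solution char0 C.
have ux := unitps_mx x0.
exists x; split.
- split=> //; exists C; split=> // n lt_nq.
  by rewrite CE ABq ?subrr // ltz_nat.
- move=> Z; rewrite (gaugeE _ ux) xC mulmxK // (conjFD x A Z).
  have -> : conjF x A = A.
    apply: coefmxP => j; apply/eqP; rewrite -subr_eq0; apply/eqP.
    apply: (coefmx_conjF_mod (@subspace_zero k N N) x0) => n.
    apply: (mcoef_conj_in char0 x0 xC (@subspace_zero k N N)) => [i|i Y -> /=].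
      exact: (Lie_torus_bracket hT).
    exact: bracket0r.
  have -> : mxF C = B - A.
    apply: coefmxP => j; rewrite coefmx_mxF coefmxB; case: ifP => [le0|/negbT lt0].
      by rewrite CE gez0_abs.
    by rewrite AB0 ?subrr //; lia.
  by rewrite addrAC addrCA subrr addr0.
- move=> Z UZ j; rewrite -[X in Lie U X](subrK (coefmx Z j)).
  apply: (subspaceD (Lie_subspace U) _ (UZ j)).
  apply: (coefmx_conjF_mod (Lie_subspace U) x0) => n.
  apply: (mcoef_conj_in char0 x0 xC (Lie_subspace U)) => [i|i Y];
    by apply: (Lie_normalizes_U hG hU hGTU) => //; apply: TG.
Qed.

Variable n : nat.
Hypothesis hn : nilpotency_class U n.
Variables (D : 'M[k]_N) (K0 delta : nat) (m : int).
Hypotheses (TD : Lie T D) (le_m : m <= K0%:Z) (le_delta : - delta%:Z <= m + 1).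
Hypothesis inj : forall i Y, (K0 <= i)%N -> Lie U Y ->
  bracket D Y = i.+1%:R *: Y -> Y = 0.

(** [gauge_descent] along the Lie algebras of the upper central series, which reaches U at index
    n+1; hence n losses of delta. *)
Lemma unipotent_gauge (K : nat) A B :
    (forall j, Lie U (coefmx A j)) -> (forall j : int, j < m -> coefmx A j = 0) ->
    (forall j, Lie U (coefmx B j)) -> (n * delta + K0 <= K)%N ->
    (forall j : int, j < K%:Z -> coefmx A j = coefmx B j) ->
  exists2 x, integral_curve (Lie U) K0 x &
    gauge (mxF x) (tmx (-1) D + A) = tmx (-1) D + B.
Proof.
move=> UA Am UB le_K ABK.
have algU : linear_alggroup U by case: hU.
apply: (@gauge_descent _ _ char0 (fun i => Lie (upper_central U i)) (Lie U) D K0 delta m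
  _ _ _ _ _ _ inj le_m le_delta n.+1 K A B UA Am) => //.
- by move=> i; apply: Lie_subspace.
- exact: Lie_alggroup_subalgebra.
- exact: Lie_upper_central0.
- exact: Lie_upper_central_sub.
- by move=> i X Y; apply: Lie_upper_central_bracket.
- move=> i X; apply: (Lie_normalizes_upper_central hG hU hGTU); exact: TG.
- by move=> j; case: hn => -> _; apply: (subspaceB (Lie_subspace U)).
Qed.

(** Let w carry A^T to B^T, let x carry B^T to D/t, and let y match the unipotent parts over D/t;
    the answer is x^-1 y x w. Although x is only 1 mod t, it enters through a conjugation and does
    not spoil the congruence. *)
Lemma semidirect_gauge (K q : nat) AT AU BT BU :
    (forall j, Lie T (coefmx AT j)) -> (forall j, Lie T (coefmx BT j)) ->
    (forall j, Lie U (coefmx AU j)) -> (forall j, Lie U (coefmx BU j)) ->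
    (forall j : int, j < -1 -> coefmx BT j = 0) -> coefmx BT (-1) = D ->
    (forall j : int, j < m -> coefmx AU j = 0) ->
    (forall j : int, j < q%:Z -> coefmx AT j = coefmx BT j) ->
    (forall j : int, j < K%:Z -> coefmx AU j = coefmx BU j) ->
    K%:Z <= q%:Z + 1 + m -> (n * delta + K0 <= K)%N ->
  exists x, [/\ points G x, zero_below (minn q.+1 K0.+1) (x - 1%:M)
    & gauge (mxF x) (AT + AU) = BT + BU].
Proof.
move=> TAT TBT UAU UBU BTm BTD AUm ABT ABU le_Kq le_K.
have [w [iw gw Uw]] := torus_gauge TAT TBT
  (fun j lt_j => ABT j (lt_le_trans lt_j (le0z_nat q))) ABT.
have Ttmx j : Lie T (coefmx (tmx (-1) D) j).
  by rewrite coefmx_tmx; case: ifP => // _; case: (Lie_subspace T).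
have BTtmx (j : int) : j < 0 -> coefmx BT j = coefmx (tmx (-1) D) j.
  rewrite coefmx_tmx => lt_j0; case: eqP => [->//|ne].
  by rewrite BTm //; lia.
have [x [ix gx Ux]] := torus_gauge TBT Ttmx BTtmx (q := 0) BTtmx.
have w1 := integral_curve_cong char0 iw; have x1 := integral_curve_cong char0 ix.
have [[w0 _] [x0 _]] := (iw, ix).
have AU'm (j : int) : j < m -> coefmx (conjF w AU) j = 0.
  by move=> lt_j; rewrite (coefmx_conjF_small w0 w1 AUm) ?AUm //; lia.
(* w = 1 mod t^(q+1) and A^U starts at t^m, so contact K survives because K <= q+1+m. *)
have AU'K (j : int) : j < K%:Z -> coefmx (conjF w AU - BU) j = 0.
  move=> lt_j; rewrite coefmxB (coefmx_conjF_small w0 w1 AUm); last lia.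
  by rewrite ABU // subrr.
(* x conjugates both unipotent parts, so it acts on their difference, which starts at order K. *)
have xK (j : int) : j < K%:Z -> coefmx (conjF x (conjF w AU)) j = coefmx (conjF x BU) j.
  move=> lt_j; have E : coefmx (conjF x (conjF w AU - BU)) j = 0.
    have := coefmx_conjF_small (j := j) x0 x1 AU'K; rewrite (AU'K j lt_j); apply.
    by lia.
  have -> : conjF x (conjF w AU) = conjF x (conjF w AU - BU) + conjF x BU.
    by rewrite -(conjFD x (conjF w AU - BU) BU) subrK.
  by rewrite coefmxD E add0r.
have xm (j : int) : j < m -> coefmx (conjF x (conjF w AU)) j = 0.
  by move=> lt_j; rewrite (coefmx_conjF_small x0 x1 AU'm) ?AU'm //; lia.
have [y iy gy] := unipotent_gauge (Ux _ (Uw _ UAU)) xm (Ux _ UBU) le_K xK.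
have [ux uy uw] := And3 (integral_curve_unit ix) (integral_curve_unit iy)
  (integral_curve_unit iw).
have ux' : invmx x \in unitmx by rewrite unitmx_inv.
exists (invmx x *m (y *m (x *m w))); split.
- have [[G1 GM GV Gu] _] := hG; apply: (integral_curve_points char0 G1 GM Gu (e := 0)).
  have sG := Lie_alggroup_subalgebra hG.
  have sub V e z : (forall X, Lie V X -> Lie G X) -> integral_curve (Lie V) e z ->
      integral_curve (Lie G) 0 z.
    by move=> VG; apply: integral_curve_sub.
  apply: integral_curveM => //; first by apply: integral_curveV => //; apply: sub ix.
  apply: integral_curveM => //; first exact: sub iy.
  by apply: integral_curveM => //; [apply: sub ix | apply: sub iw].
(* Splitting off w - 1 leaves y - 1 multiplied by units, so the order is the smaller of those of y -
   1 and w - 1. *)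
- have -> : invmx x *m (y *m (x *m w)) - 1%:M =
      invmx x *m ((y - 1%:M) *m (x *m w)) + (w - 1%:M).
    by rewrite mulmxBl mulmxBr mul1mx mulKmx // addrA subrK.
  apply: zero_belowD => [|j lt_j]; last by apply: w1; rewrite (leq_trans lt_j) ?geq_minl.
  apply/zero_below_mull/zero_below_mulr => j lt_j.
  by apply: (integral_curve_cong char0 iy); rewrite (leq_trans lt_j) ?geq_minr.
- have uxw : x *m w \in unitmx by rewrite unitmx_mul ux.
  have uyxw : y *m (x *m w) \in unitmx by rewrite unitmx_mul uy.
  rewrite (gaugeM _ ux' uyxw) (gaugeM _ uy uxw) (gaugeM _ ux uw) gw gx gy -gx.
  by rewrite -(gaugeM _ ux' ux) mulVmx // gauge1.
Qed.

End Assembly.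

Theorem proposition3p29
  (k : closedFieldType) (char0 : [pchar k] =i pred0)
  (pi : k -> rat)
  (pi_linear : forall (q : rat) (x y : k),
     pi (ratr q * x + y) = q * pi x + pi y)
  (pi1 : pi 1 = 1)
  (N : nat) (G T U : set 'M[k]_N)
  (hG : linear_alggroup G) (hT : torus T) (hU : unipotent U)
  (hGTU : semidirect G T U)
  (n : nat) (hn : nilpotency_class U n)
  (AT AU : 'M[laurent k]_N) (p : nat) (m : int)
  (hAT : base_change (Lie T) AT)
  (hATp : forall j : int, j < p%:Z -> j != -1 -> coefmx AT j = 0)
  (hAU : base_change (Lie U) AU)
  (hAUm : forall j : int, j < m -> coefmx AU j = 0)
  (l : nat) (chi : 'I_l -> 'M[k]_N -> k) (hchi : weights_of T U chi)
  (b : nat) (b_gt0 : (0 < b)%N)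
  (mu : k -> 'M[k]_N) (hmu : cocharacter T mu)
  (hmu_pi : pi_ext_eq pi T b (coefmx AT (-1)) mu)
  (L : rat)
  (hL : L = \big[Num.max/0]_(i < l) ((pairing mu (chi i))%:~R / b%:R)) :
  (L - 1 < m%:~R ->
     (exists x : 'M[pseries k]_N,
        points G x /\
        gauge (mxF x) (AT + AU) = tmx (-1) (coefmx AT (-1))) /\
     (exists xT xU : 'M[pseries k]_N,
        [/\ points T xT /\ eqmodt (p%:Z + 1) (mxF xT) 1%:M,
            points U xU /\ eqmodt (m + 1) (mxF xU) 1%:M
          & gauge (mxF (xU *m xT)) (AT + AU) = tmx (-1) (coefmx AT (-1))])) /\
  (m%:~R <= L - 1 ->
   (* for m = 0 < n the claim fails; a connection with m = 0 < L is covered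
      by taking m = -1 instead *)
   m != 0 \/ n = 0%N ->
     (forall (BT BU : 'M[laurent k]_N),
        base_change (Lie T) BT ->
        base_change (Lie U) BU ->
        (forall j : int, j < -1 -> coefmx BT j = 0) ->
        (forall j : int, j < m -> coefmx BU j = 0) ->
        (forall j : int, -1 <= j ->
           j%:~R < (n%:R + 1) * (`|m|%:~R - 1) + L ->
           coefmx BT j = coefmx AT j) ->
        (forall j : int, m <= j ->
           j%:~R < n%:R * (`|m|%:~R - 1) + L ->
           coefmx BU j = coefmx AU j) ->
        exists x : 'M[laurent k]_N,
          points G x /\ gauge x (AT + AU) = BT + BU) /\
     (forall (BT BU : 'M[laurent k]_N) (K : nat),
        base_change (Lie T) BT ->
        base_change (Lie U) BU ->
        (0 < K)%N ->
        n%:R * (`|m|%:~R - 1) + L <= K%:R ->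
        eqmodt (K%:Z + `|m|) BT AT ->
        eqmodt K%:Z BU AU ->
        exists x : 'M[pseries k]_N,
          [/\ points G x,
              eqmodt (K%:Z - n%:Z * `|m| + n%:Z + 1) (mxF x) 1%:M
            & gauge (mxF x) (AT + AU) = BT + BU])).
Proof.
have [[sT sU] [algT algU]] : (subspace (Lie T) /\ subspace (Lie U)) /\
    (linear_alggroup T /\ linear_alggroup U).
  by split; [split; apply: Lie_subspace | split; [case: hT | case: hU]].
set D := coefmx AT (-1) in hmu_pi *.
have TAT j : Lie T (coefmx AT j) := base_change_coef j sT hAT.
have UAU j : Lie U (coefmx AU j) := base_change_coef j sU hAU.
have TD : Lie T D := TAT (-1).
have L_ge0 : 0 <= L by rewrite hL; apply: bigmax_ge_id.
(* For i >= K0 > L - 1 the integer i + 1 exceeds L, so it cannot be an eigenvalue of ad D on Lie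
   U. *)
have inj (K0 : nat) : L - 1 < K0%:R -> forall i Y, (K0 <= i)%N -> Lie U Y ->
    bracket D Y = i.+1%:R *: Y -> Y = 0.
  move=> lt_L i Y le_K0i UY DY; apply/eqP/negPn/negP => Y0.
  have := eigenvalue_le_weights char0 pi_linear pi1 hT hU hGTU hchi b_gt0 hmu hmu_pi
    UY Y0 DY.
  rewrite -hL; apply/negP; rewrite -ltNge; move: lt_L.
  rewrite ltrBlDr -natr1 => /lt_le_trans; apply.
  by rewrite lerD2r ler_nat.
have ATm (j : int) : j < -1 -> coefmx AT j = 0.
  by move=> lt_j; apply: hATp; lia.
split=> [lt_m|le_m mn0].
  (* m > L - 1 >= -1 forces the unipotent part to be free of poles. *)
  have m_ge0 : 0 <= m.
    rewrite -ltzD1 -(ltr_int rat) intrD; move: lt_m L_ge0; clear; lra.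
  have [M mE] : exists M : nat, m = M%:Z by exists (absz m); rewrite gez0_abs.
  have injM : L - 1 < M%:R by move: lt_m; rewrite mE.
  have Ttmx j : Lie T (coefmx (tmx (-1) D) j).
    by rewrite coefmx_tmx; case: ifP => // _; case: sT.
  have ATtmx (j : int) : j < p%:Z -> coefmx AT j = coefmx (tmx (-1) D) j.
    by rewrite coefmx_tmx => lt_j; case: eqP => [->//|/eqP ne]; apply: hATp.
  have AT0 (j : int) : j < 0 -> coefmx AT j = coefmx (tmx (-1) D) j.
    by move=> lt_j; apply: ATtmx; apply: lt_le_trans lt_j _.
  have [xT [ixT gxT UxT]] := torus_gauge char0 hG hT hU hGTU TAT Ttmx AT0 ATtmx.
  have [xT0 _] := ixT; have xT1 := integral_curve_cong char0 ixT.
  have A'm (j : int) : j < m -> coefmx (conjF xT AU) j = 0.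
    by move=> lt_j; rewrite (coefmx_conjF_small xT0 xT1 hAUm) ?hAUm //; lia.
  have coef0 (j : int) : coefmx (0 : 'M[laurent k]_N) j = 0.
    by apply/matrixP => a c; rewrite !mxE.
  have U0 j : Lie U (coefmx (0 : 'M[laurent k]_N) j) by rewrite coef0; case: sU.
  (* With m >= 0 a descent costs nothing, so delta = 0; A^U already agrees with the target 0 below
     order m, whence K0 = K = m. *)
  have [||||xU ixU gxU] := @unipotent_gauge k char0 N G T U hG hU hGTU n hn D M 0 m TD
    _ _ (inj M injM) M (conjF xT AU) 0 (UxT _ UAU) A'm U0.
  - by rewrite mE.
  - by lia.
  - by rewrite muln0.
  - by move=> j; rewrite -mE coef0; apply: A'm.
  have gx : gauge (mxF (xU *m xT)) (AT + AU) = tmx (-1) D.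
    rewrite (gaugeM _ (integral_curve_unit ixU) (integral_curve_unit ixT)) gxT gxU.
    by rewrite addr0.
  have ptT : points T xT.
    by case: algT => -[T1 TM _ Tu] _; apply: integral_curve_points ixT.
  have ptU : points U xU.
    by case: algU => -[U1 UM _ Uu] _; apply: integral_curve_points ixU.
  split.
    exists (xU *m xT); split=> //; have [[G1 GM _ Gu] _] := hG.
    apply: (integral_curve_points char0 G1 GM Gu (e := 0)).
    apply: integral_curveM => //; first exact: Lie_alggroup_subalgebra.
      by apply: integral_curve_sub ixU => //; apply: Lie_U_G hGTU.
    by apply: integral_curve_sub ixT => //; apply: Lie_T_G hGTU.
  exists xT, xU; split=> //; split=> //.
    by apply: zero_below_eqmodt xT1 _; lia.
  by apply: zero_below_eqmodt (integral_curve_cong char0 ixU) _; lia.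
(* For m < 0 this is exactly the cost -m-1 of one descent; for m > 0 it is an upper bound. At m = 0
   the truncated subtraction gives 0 instead of -1, so [nd] then relies on n = 0. *)
pose delta := (absz m - 1)%N.
have nd : n%:R * (`|m|%:~R - 1) = (n * delta)%:R :> rat.
  case: mn0 => [m0|->]; last by rewrite mul0r mul0n.
  rewrite natrM; congr (_ * _); rewrite /delta natrB ?absz_gt0 //.
have le_delta : - delta%:Z <= m + 1 by rewrite /delta; lia.
(* Both claims of (ii) take K0 = K - n delta: the bound on K makes K0 >= L, which is above L - 1 and
   at least m. *)
have common (K q : nat) (BT BU : 'M[laurent k]_N) :
    base_change (Lie T) BT -> base_change (Lie U) BU ->
    (forall j : int, j < -1 -> coefmx BT j = 0) ->
    coefmx BT (-1) = D ->
    (forall j : int, j < q%:Z -> coefmx AT j = coefmx BT j) ->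
    (forall j : int, j < K%:Z -> coefmx AU j = coefmx BU j) ->
    K%:Z <= q%:Z + 1 + m -> n%:R * (`|m|%:~R - 1) + L <= K%:R ->
  (n * delta <= K)%N /\ exists x, [/\ points G x,
    zero_below (minn q.+1 (K - n * delta).+1) (x - 1%:M)
    & gauge (mxF x) (AT + AU) = BT + BU].
  move=> hBT hBU BTm BTD ABT ABU le_Kq; rewrite nd => le_K.
  have le_ndK : (n * delta <= K)%N.
    by rewrite -(ler_nat rat); apply: le_trans le_K; rewrite lerDl.
  split=> //; have LK : L <= (K - n * delta)%:R by rewrite natrB // lerBrDl.
  apply: (@semidirect_gauge k char0 N G T U hG hT hU hGTU n hn D (K - n * delta)%N delta m
    TD _ le_delta _ K q AT AU BT BU TAT _ UAU _ BTm BTD hAUm ABT ABU le_Kq).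
  - rewrite -(ler_int rat); apply: le_trans le_m _; apply: le_trans LK.
    by rewrite lerBlDr lerDl.
  - by apply: inj; apply: lt_le_trans LK; rewrite ltrBlDr ltrDl.
  - by move=> j; apply: base_change_coef sT hBT.
  - by move=> j; apply: base_change_coef sU hBU.
  - by rewrite subnKC.
split.
  move=> BT BU hBT hBU BTm BUm ABT ABU.
  set R1 := n%:R * _ + L in ABU.
  have R1_ge0 : 0 <= R1 by rewrite /R1 nd addr_ge0 ?ler0n.
  have exK : exists K : nat, R1 <= K%:R.
    by exists (Num.bound R1); apply/ltW/archi_boundP.
  (* The least natural number K >= R1, so that every integer below K is also below R1 and only
     prescribed coefficients are compared. *)
  pose K := ex_minn exK.
  have [R1K ltK] : R1 <= K%:R /\ forall j : int, j < K%:Z -> j%:~R < R1.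
    rewrite /K; case: ex_minnP => K' le_K' minK'; split=> // j lt_j.
    case: (ltP j 0) => [lt_j0|le_0j].
      by apply: lt_le_trans R1_ge0; rewrite ltrz0.
    rewrite ltNge; apply/negP => le_R1; have := minK' (absz j).
    by rewrite pmulrn gez0_abs // => /(_ le_R1); lia.
  (* This makes q = |m| + K - 1 an honest subtraction and puts the residue among the prescribed
     coefficients. When m = 0, positivity of K comes from R1 >= L >= 1. *)
  have K_ge : (0 < absz m + K)%N.
    rewrite addn_gt0 absz_gt0; case: (eqVneq m 0) => //= m0; rewrite lt0n.
    apply/eqP => K0; move: R1K; rewrite K0 leNgt => /negP; apply.
    apply: lt_le_trans (_ : L <= _); last by rewrite /R1 nd lerDr.
    by move: le_m; rewrite m0; clear; lra.
  have R2E : (n%:R + 1) * (`|m|%:~R - 1) + L = R1 + (`|m|%:~R - 1).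
    by rewrite mulrDl mul1r addrAC.
  have lt_R2 (j : int) : j + 1 < K%:Z + `|m| -> j%:~R < R1 + (`|m|%:~R - 1).
    move=> lt_j; have : (j + 1 - `|m|)%:~R < R1 by apply: ltK; lia.
    by rewrite !intrD mulrNz; clear; lra.
  have [|||||_ [x [ptx _ gx]]] := common K (absz m + K - 1)%N BT BU hBT hBU BTm => //.
  - by apply: ABT => //; rewrite R2E; apply: lt_R2; lia.
  - move=> j lt_j; case: (ltP j (-1)) => [lt_j1|le_1j]; first by rewrite ATm ?BTm.
    by apply/esym/ABT => //; rewrite R2E; apply: lt_R2; lia.
  - move=> j lt_j; case: (ltP j m) => [lt_jm|le_mj]; first by rewrite hAUm ?BUm.
    by apply/esym/ABU => //; apply: ltK.
  - by lia.
  by exists (mxF x); split=> //; apply: points_laurent.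
move=> BT BU K hBT hBU K_gt0 le_K eqT eqU.
have BTA (j : int) : j < K%:Z + `|m| -> coefmx BT j = coefmx AT j by apply: eqT.
have [||||||le_ndK [x [ptx x1 gx]]] := common K (K + absz m)%N BT BU hBT hBU => //.
- by move=> j lt_j; rewrite BTA ?ATm //; lia.
- by apply: BTA; lia.
- by move=> j lt_j; rewrite BTA //; lia.
- by move=> j lt_j; rewrite eqU.
- by lia.
exists x; split=> //; apply: zero_below_eqmodt x1 _.
(* Back from the truncated delta to the exponent of the claim; m = 0 again goes through n = 0. *)
have ndE : (n * delta)%:Z = n%:Z * `|m| - n%:Z.
  case: mn0 => [m0|->]; last by rewrite mul0n mul0r subr0.
  by rewrite PoszM -[X in _ - X]mulr1 -mulrBr /delta; congr (_ * _); lia.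
rewrite (_ : K%:Z - n%:Z * `|m| + n%:Z + 1 = (K - n * delta).+1%:Z); last by lia.
by rewrite lez_nat leq_min leqnn andbT ltnS (leq_trans (leq_subr _ _)) // leq_addr.
Qed.
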